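(* Let $0<\delta<1$, let $q\ge1$ be an integer, and let $1\le K\le N$ and $M\ge1$ be integers. Construct an $M\times N$ matrix $\Phi$ by drawing each of its entries independently from a (real) Gaussian distribution with mean zero and variance $\frac1M$, and let $$\delta_{K;q}:=\max_{\substack{\mathcal K\subseteq\{1,\ldots,N\}\\|\mathcal K|=K}}\mathrm{Tr}\left[(\Phi_{\mathcal K}^*\Phi_{\mathcal K}-I_K)^{2q}\right]^{\frac1{2q}}.$$ Then $\delta_{K;q}\le\delta$, and therefore $\Phi$ has the $(K,\delta)$-restricted isometry property, with high probability provided $M\ge\frac{81}{\delta^2}K^{1+1/q}\log\frac{eN}{K}$. Here ''with high probability'' means: for every $\eta>0$ there is $N_0$ such that for all integers $N\ge N_0$, all real $\delta$ with $0<\delta<1$, all integers $q\ge1$, all integers $K$ with $1\le K\le N$, and all integers $M\ge1$ satisfying $M\ge\frac{81}{\delta^2}K^{1+1/q}\log\frac{eN}{K}$, the conclusion holds with probability at least $1-\eta$.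
   Context: $\log$ is the natural logarithm. $\Phi_{\mathcal K}$ is the submatrix of columns of $\Phi$ indexed by $\mathcal K$, and $I_K$ is the $K\times K$ identity. $\Phi$ has the $(K,\delta)$-restricted isometry property if $(1-\delta)\|x\|^2\le\|\Phi x\|^2\le(1+\delta)\|x\|^2$ for every vector $x$ with at most $K$ nonzero entries. *)

(* Defs.v *)
From mathcomp Require Export all_boot all_order all_algebra.
From mathcomp Require Export all_classical all_reals all_analysis.

Set Implicit Arguments.
Unset Strict Implicit.
Unset Printing Implicit Defensive.

Import Order.TTheory GRing.Theory Num.Theory.
Import numFieldNormedType.Exports.

Local Open Scope classical_set_scope.
Local Open Scope ring_scope.

(* The library norm on matrices is the sup norm, so the squared Euclidean norm
   is spelled out. *)
Definition sqnorm2 (R : realType) (n : nat) (x : 'cV[R]_n) : R :=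
  \sum_(i < n) x i 0 ^+ 2.

Definition nnz (R : realType) (n : nat) (x : 'cV[R]_n) : nat :=
  #|[pred i | x i 0 != 0]|.

Definition rip (R : realType) (M N : nat) (Phi : 'M[R]_(M, N))
    (K : nat) (delta : R) : Prop :=
  forall x : 'cV[R]_N, (nnz x <= K)%N ->
    (1 - delta) * sqnorm2 x <= sqnorm2 (Phi *m x)
      <= (1 + delta) * sqnorm2 x.

(* Columns of Phi indexed by A, in increasing order. *)
Definition colset (R : realType) (M N : nat) (Phi : 'M[R]_(M, N))
    (A : {set 'I_N}) : 'M[R]_(M, #|A|) :=
  colsub (fun j : 'I_#|A| => enum_val j) Phi.

(* Phi is real, so the adjoint is the transpose. The values of powR are
   nonnegative, so the default value 0 of the iterated maximum is harmless as
   soon as K <= N. *)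
Definition power_delta (R : realType) (M N : nat) (Phi : 'M[R]_(M, N))
    (K q : nat) : R :=
  \big[Num.max/0]_(A : {set 'I_N} | #|A| == K)
    (\tr (((colset Phi A)^T *m colset Phi A - 1%:M) ^+ (2 * q)))
      `^ ((2 * q)%:R^-1).

(* Mutual independence of a finite family of real random variables. *)
Definition mutually_independent (R : realType) (d : measure_display)
    (T : measurableType d) (P : probability T R) (I : finType)
    (X : I -> {RV P >-> R}) : Prop :=
  forall (J : {set I}) (B : I -> set R),
    (forall i, measurable (B i)) ->
    P [set w | forall i, i \in J -> B i (X i w)]
    = (\prod_(i in J) P (X i @^-1` B i))%E.

(* The second parameter of normal_prob is the standard deviation. *)
Definition gaussian_rv (R : realType) (d : measure_display)
    (T : measurableType d) (P : probability T R) (X : {RV P >-> R})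
    (mean var : R) : Prop :=
  forall B : set R, measurable B ->
    distribution P X B = normal_prob mean (Num.sqrt var) B.

Definition gaussian_matrix (R : realType) (d : measure_display)
    (T : measurableType d) (P : probability T R) (M N : nat)
    (X : 'I_M * 'I_N -> {RV P >-> R}) : Prop :=
  mutually_independent X /\ forall ij, gaussian_rv (X ij) 0 (M%:R^-1).

Definition matrix_at (R : realType) (d : measure_display)
    (T : measurableType d) (P : probability T R) (M N : nat)
    (X : 'I_M * 'I_N -> {RV P >-> R}) (w : T) : 'M[R]_(M, N) :=
  \matrix_(i < M, j < N) X (i, j) w.

(* Main.v *)
From HB Require Import structures.
Require Import Defs.
From mathcomp Require Import all_boot all_order all_algebra.
From mathcomp Require Import all_classical all_reals all_analysis.
From mathcomp Require Import measurable_realfun zify ring lra.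

Import Order.TTheory GRing.Theory Num.Theory.
Import numFieldNormedType.Exports.

Local Open Scope classical_set_scope.
Local Open Scope ring_scope.

Set Implicit Arguments.
Unset Strict Implicit.
Unset Printing Implicit Defensive.

(** Put [eps = delta / K `^ (2 q)^-1]. A symmetric matrix of size [K] whose
    quadratic form is at most [eps |v|^2] in absolute value has
    [\tr (W ^+ (2 q)) <= K eps ^ (2 q) = delta ^ (2 q)], so the bound on
    [power_delta] follows once every vector with at most [K] nonzero entries
    has its squared norm preserved by [Phi] up to the relative error [eps]
    ([power_delta_of_lattice]). In terms of [eps] the hypothesis on [M] reads
    [M >= 81 / eps^2 * L] with [L = K ln (e N / K)]: it is the sample complexity
    of restricted isometry with constant [eps], and the exponent [1 + 1 / q]
    disappears from the rest of the argument.

    Restricted isometry is proved by concentration and a union bound, with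
    lattice points in place of an epsilon-net of the sphere. If a quadratic form
    in [n] variables is at most [a |z|^2] at every integer vector [z] with
    [|z|^2 <= 4 n], it is at most [5 / 3 * a |x|^2] everywhere
    ([form_le_of_lattice]): rounding the coordinates of a vector of squared norm
    [n] to neighbouring integers, in the favourable direction, lowers the form by
    a second-order term at most. So [a = 3 / 5 * eps] suffices. The relevant
    integer vectors in dimension [N] are counted by a generating function;
    there are at most [expR (5 / 2 * K + L)] of them ([card_words_le_expR]).

    For one vector [z], the Laplace transform of [|Phi z|^2] is computed by
    integrating out the entries of [Phi] one after the other: a Gaussian
    integral of [expR (- s (u + z x)^2)] in [x] is again of this form in [u]
    ([integral_normal_expR_sqr]), and independence lets each entry be integrated
    against its own law while the earlier ones are frozen
    ([indep_of_integral], [indep_of_merge]). The exponential Markov inequality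
    then bounds the probability of a relative error [a] by
    [2 expR (- a^2 M / 8)] ([chi_square_concentration]). With [a = 3 / 5 * eps]
    the exponent is at least [3.645 L], which beats [5 / 2 * K + L <= 3.5 L],
    and what is left tends to [0] because [L >= ln N].

    That the bound on [power_delta] implies restricted isometry is
    deterministic ([rip_of_power_delta]); it also reduces the event of the
    theorem to a measurable one. *)

(** * Euclidean norms, operator norms and traces *)

Section EuclideanSpace.
Context {R : realType}.

Definition dot n (u v : 'cV[R]_n) : R := (u^T *m v) 0 0.

Lemma dotE n (u v : 'cV[R]_n) : dot u v = \sum_i u i 0 * v i 0.
Proof. by rewrite /dot mxE; apply: eq_bigr => i _; rewrite mxE. Qed.

Lemma dotC n (u v : 'cV[R]_n) : dot u v = dot v u.
Proof. by rewrite !dotE; apply: eq_bigr => i _; rewrite mulrC. Qed.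

Lemma dotDr n (u v w : 'cV[R]_n) : dot u (v + w) = dot u v + dot u w.
Proof. by rewrite /dot mulmxDr mxE. Qed.

Lemma dotZr n a (u v : 'cV[R]_n) : dot u (a *: v) = a * dot u v.
Proof. by rewrite /dot -scalemxAr mxE. Qed.

Lemma dotDl n (u v w : 'cV[R]_n) : dot (u + v) w = dot u w + dot v w.
Proof. by rewrite dotC dotDr ![dot w _]dotC. Qed.

Lemma dotZl n a (u v : 'cV[R]_n) : dot (a *: u) v = a * dot u v.
Proof. by rewrite dotC dotZr dotC. Qed.

Lemma dot_mulmxl m n (A : 'M[R]_(m, n)) u v : dot (A *m u) v = dot u (A^T *m v).
Proof. by rewrite /dot trmx_mul mulmxA. Qed.

Lemma sqnorm2_dot n (x : 'cV[R]_n) : sqnorm2 x = dot x x.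
Proof. by rewrite dotE /sqnorm2; apply: eq_bigr => i _; rewrite expr2. Qed.

Lemma sqnorm2_ge0 n (x : 'cV[R]_n) : 0 <= sqnorm2 x.
Proof. by apply: sumr_ge0 => i _; exact: sqr_ge0. Qed.

Lemma sqnorm2_eq0 n (x : 'cV[R]_n) : (sqnorm2 x == 0) = (x == 0).
Proof.
apply/idP/eqP => [|->]; last by rewrite sqnorm2_dot dotE big1// => i; rewrite mxE mul0r.
rewrite psumr_eq0 => [/allP x0|i _]; last exact: sqr_ge0.
apply/matrixP => i j; rewrite ord1 mxE.
by have := x0 i (mem_index_enum _); rewrite sqrf_eq0 => /eqP.
Qed.

Lemma sqnorm2Z n a (x : 'cV[R]_n) : sqnorm2 (a *: x) = a ^+ 2 * sqnorm2 x.
Proof. by rewrite !sqnorm2_dot dotZl dotZr mulrA expr2. Qed.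

Lemma cauchy_schwarz n (u v : 'cV[R]_n) :
  dot u v ^+ 2 <= sqnorm2 u * sqnorm2 v.
Proof.
have [v0|vn0] := eqVneq (sqnorm2 v) 0.
  move/eqP: (v0); rewrite sqnorm2_eq0 => /eqP->.
  by rewrite dotE big1 ?expr0n ?mulr_ge0 ?sqnorm2_ge0// => i _; rewrite mxE mulr0.
have v0 : 0 < sqnorm2 v by rewrite lt_neqAle eq_sym vn0 sqnorm2_ge0.
have := sqnorm2_ge0 (sqnorm2 v *: u + - dot u v *: v).
rewrite [in X in 0 <= X]sqnorm2_dot !(dotDl, dotDr, dotZl, dotZr) -!sqnorm2_dot.
rewrite (dotC v u) => h.
rewrite -(ler_pM2l v0) -subr_ge0; apply: le_trans h _.
by rewrite le_eqVlt; apply/orP; left; apply/eqP; ring.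
Qed.

(** Polarization between [W v + c v] and [W v - c v] turns a bound on the
    quadratic form into a bound on the operator norm. *)
Lemma sqnorm2_mulmx_le_of_form n (W : 'M[R]_n) c : 0 < c -> W^T = W ->
  (forall v, `|dot v (W *m v)| <= c * sqnorm2 v) ->
  forall v, sqnorm2 (W *m v) <= c ^+ 2 * sqnorm2 v.
Proof.
move=> c0 WT Wc v.
have /ler_normlP[_ h1] := Wc (W *m v + c *: v).
have /ler_normlP[h2 _] := Wc (W *m v + - c *: v).
have /ler_wpM2l : 0 <= c by exact: ltW.
have E : dot v (W *m (W *m v)) = sqnorm2 (W *m v).
  by rewrite sqnorm2_dot dot_mulmxl WT.
move: h1 h2.
rewrite !mulmxDr -!scalemxAr !sqnorm2_dot !(dotDl, dotDr, dotZl, dotZr).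
rewrite (dotC v (W *m v)) E sqnorm2_dot => h1 h2 _.
have := lerD h1 h2.
set a := dot (W *m v) (W *m v); set b := dot v v; set d := dot _ (W *m (W *m v)).
set e := dot (W *m v) v => h.
have : (2 * c) * a <= (2 * c) * (c ^+ 2 * b) by lra.
by rewrite ler_pM2l// mulr_gt0.
Qed.

Lemma trmxX n (W : 'M[R]_n) k : W^T = W -> (W ^+ k)^T = W ^+ k.
Proof.
move=> WT; elim: k => [|k IH]; first by rewrite !expr0 trmx1.
by rewrite {1}exprS [LHS]trmx_mul IH WT exprSr.
Qed.

Lemma trace_even_pow n (W : 'M[R]_n) q : W^T = W ->
  \tr (W ^+ (2 * q)) = \sum_i \sum_j (W ^+ q) i j ^+ 2.
Proof.
move=> WT; rewrite mulnC exprM expr2 -{1}(trmxX q WT) /mxtrace.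
rewrite exchange_big; apply: eq_bigr => i _.
rewrite (mxE _ _ i i); apply: eq_bigr => j _.
by rewrite mxE -expr2.
Qed.

Lemma trace_even_pow_le n (W : 'M[R]_n) c q : 0 <= c -> W^T = W ->
  (forall v, sqnorm2 (W *m v) <= c ^+ 2 * sqnorm2 v) ->
  \tr (W ^+ (2 * q)) <= n%:R * c ^+ (2 * q).
Proof.
move=> c0 WT Wc; rewrite trace_even_pow// exchange_big/=.
have Wq v : sqnorm2 (W ^+ q *m v) <= (c ^+ 2) ^+ q * sqnorm2 v.
  elim: q => [|q IH]; first by rewrite !expr0 mul1mx mul1r.
  rewrite (exprS W) -mulmxA (le_trans (Wc _))// (exprS (c ^+ 2)) -mulrA.
  by rewrite ler_wpM2l// sqr_ge0.
rewrite -[n in n%:R]card_ord -sum1_card natr_sum mulr_suml.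
apply: ler_sum => j _; rewrite mul1r exprM.
have := Wq (delta_mx j 0); rewrite [X in _ * X](_ : _ = 1) ?mulr1; last first.
  rewrite /sqnorm2 (bigD1 j)//= !mxE !eqxx/= expr1n big1 ?addr0// => i ij.
  by rewrite mxE (negbTE ij) expr0n.
apply: le_trans; rewrite /sqnorm2 le_eqVlt; apply/orP; left; apply/eqP.
by apply: eq_bigr => i _; rewrite -colE mxE.
Qed.

(** The successive ratios of a log-convex sequence are nondecreasing, hence at
    least the first one; cross-multiplication accommodates zero terms. *)
Lemma log_convex_pow (b : nat -> R) q : (forall k, 0 <= b k) ->
  (forall k, b k.+1 ^+ 2 <= b k * b k.+2) ->
  b 1%N ^+ q.+1 <= b 0%N ^+ q * b q.+1.
Proof.
move=> b0 bb.
have step k : b 1%N * b k <= b 0%N * b k.+1.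
  elim: k => [|k IH]; first by rewrite mulrC.
  have [bk0|bk0] := eqVneq (b k) 0.
    have := bb k; rewrite bk0 mul0r => h.
    have /eqP : b k.+1 ^+ 2 == 0 by rewrite eq_le h sqr_ge0.
    by move/eqP; rewrite sqrf_eq0 => /eqP->; rewrite mulr0 mulr_ge0.
  have bk : 0 < b k by rewrite lt_neqAle eq_sym bk0 b0.
  rewrite -(ler_pM2l bk).
  apply: (@le_trans _ _ (b 0%N * b k.+1 ^+ 2)).
    by have := ler_wpM2r (b0 k.+1) IH; rewrite expr2; lra.
  by have := ler_wpM2l (b0 0%N) (bb k); lra.
elim: q => [|q IH]; first by rewrite expr1 expr0 mul1r.
rewrite exprS (le_trans (ler_wpM2l (b0 1%N) IH))// mulrCA exprSr -[leRHS]mulrA.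
by apply: ler_wpM2l (step _); exact: exprn_ge0.
Qed.

Lemma sqnorm2_mulmx_le_frobenius m n (B : 'M[R]_(m, n)) x :
  sqnorm2 (B *m x) <= (\sum_i \sum_j B i j ^+ 2) * sqnorm2 x.
Proof.
rewrite {1}/sqnorm2 mulr_suml; apply: ler_sum => i _.
have := cauchy_schwarz (row i B)^T x.
rewrite {1}/dot trmxK -row_mul mxE => /le_trans; apply.
rewrite ler_wpM2r ?sqnorm2_ge0// le_eqVlt; apply/orP; left; apply/eqP.
by apply: eq_bigr => j _; rewrite !mxE.
Qed.

(** The Schatten norm dominates the operator norm. Instead of diagonalizing
    [W], use that [k |-> |W ^ k x|^2] is log-convex: its value at [q] bounds
    its value at [1], and the former is at most the trace. *)
Lemma form_le_of_trace n (W : 'M[R]_n) c q : 0 <= c -> W^T = W -> (0 < q)%N ->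
  \tr (W ^+ (2 * q)) <= c ^+ (2 * q) ->
  forall x, `|dot x (W *m x)| <= c * sqnorm2 x.
Proof.
move=> c0 WT q0 trW x.
pose b k := sqnorm2 (W ^+ k *m x).
have b_ge0 k : 0 <= b k by exact: sqnorm2_ge0.
have bb k : b k.+1 ^+ 2 <= b k * b k.+2.
  apply: le_trans (cauchy_schwarz _ _).
  rewrite /b sqnorm2_dot !(exprS W) -!mulmxA dot_mulmxl WT.
  exact: lexx.
have Wx : sqnorm2 (W *m x) <= c ^+ 2 * sqnorm2 x.
  case: q q0 trW => // q _ trW.
  have := log_convex_pow q b_ge0 bb.
  rewrite {1 2}/b expr1 expr0 mul1mx => h.
  rewrite -(@ler_pXn2r _ q.+1)// ?nnegrE ?mulr_ge0 ?sqr_ge0 ?sqnorm2_ge0//.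
  apply: (le_trans h); rewrite exprMn [X in _ <= _ * X]exprSr mulrCA.
  rewrite ler_wpM2l ?exprn_ge0 ?sqnorm2_ge0//.
  rewrite (le_trans (sqnorm2_mulmx_le_frobenius _ _))//.
  by rewrite ler_wpM2r ?sqnorm2_ge0// -trace_even_pow// -exprM.
rewrite -(@ler_pXn2r _ 2)// ?nnegrE ?mulr_ge0 ?sqnorm2_ge0// real_normK ?num_real//.
apply: le_trans (cauchy_schwarz _ _) _.
rewrite exprMn expr2 mulrCA mulrA [X in _ <= X]mulrC mulrA.
have := ler_wpM2l (sqnorm2_ge0 x) Wx; lra.
Qed.

End EuclideanSpace.

(** * Rounding to lattice points *)

Section LatticeRounding.
Context {R : realType}.

Lemma dot_delta_mulmx n (W : 'M[R]_n) i :
  dot (delta_mx i 0) (W *m delta_mx i 0) = W i i.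
Proof.
rewrite -colE dotE (bigD1 i)//= !mxE !eqxx mul1r big1 ?addr0// => j ji.
by rewrite !mxE (negbTE ji) mul0r.
Qed.

(** Round one coordinate at a time. Along a coordinate line the form is a
    quadratic polynomial with leading coefficient [W i i], so the average of
    its values at the two neighbouring integers, weighted so that their
    barycentre is the current point, exceeds the current value by
    [p (1 - p) W i i >= - c / 4]; one of the two neighbours does at least as
    well as this average. *)
Lemma lattice_rounding n (W : 'M[R]_n) c (x : 'cV[R]_n) : 0 <= c ->
  (forall i, - c <= W i i) ->
  exists z : 'cV[R]_n, [/\ forall i, z i 0 \is a Num.int,
    forall i, `|z i 0 - x i 0| <= 1 &
    dot x (W *m x) <= dot z (W *m z) + c * n%:R / 4].
Proof.
move=> c0 Wc.
suff H (s : seq 'I_n) : uniq s -> exists z : 'cV[R]_n,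
    [/\ forall i, i \in s -> z i 0 \is a Num.int,
      forall i, i \notin s -> z i 0 = x i 0,
      forall i, `|z i 0 - x i 0| <= 1 &
      dot x (W *m x) <= dot z (W *m z) + c * (size s)%:R / 4].
  have [z [zi _ zx xz]] := H _ (enum_uniq 'I_n).
  exists z; split => // [i|]; first by apply: zi; rewrite mem_enum.
  by rewrite size_enum_ord in xz.
elim: s => [_|i s IH /= /andP[is_ us]].
  by exists x; split => // [i|]; rewrite ?subrr ?normr0//= mulr0 mul0r addr0.
have [z [zi zx zx1 xz]] := IH us.
pose y t := z + t *: delta_mx i 0.
have yE t j : y t j 0 = if j == i then z i 0 + t else z j 0.
  rewrite !mxE; case: eqVneq => [->|]; rewrite ?eqxx ?mulr1//=.
  by rewrite mulr0 addr0.
have yQ t : dot (y t) (W *m y t) = dot z (W *m z) +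
    t * (dot z (W *m delta_mx i 0) + dot (delta_mx i 0) (W *m z)) + t ^+ 2 * W i i.
  rewrite /y mulmxDr -scalemxAr !(dotDl, dotDr, dotZl, dotZr) dot_delta_mulmx; ring.
set L := dot z _ + dot _ (W *m z) in yQ.
pose p : R := x i 0 - (Num.floor (x i 0))%:~R.
have p0 : 0 <= p by rewrite subr_ge0 ge_floor.
have p1 : p < 1.
  rewrite ltrBlDl -[1 in X in _ < X]/(1%:~R) -intrD.
  by have /andP[] := floor_itv (x i 0).
have good t : t = - p \/ t = 1 - p ->
    dot z (W *m z) <= dot (y t) (W *m y t) + c / 4 ->
    exists z : 'cV[R]_n,
    [/\ forall j, j \in i :: s -> z j 0 \is a Num.int,
      forall j, j \notin i :: s -> z j 0 = x j 0,
      forall j, `|z j 0 - x j 0| <= 1 &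
      dot x (W *m x) <= dot z (W *m z) + c * (size s).+1%:R / 4].
  move=> tp Q; exists (y t); split => [j|j|j|].
  - rewrite inE yE; case: eqVneq => [_ _|_ /=]; last exact: zi.
    rewrite zx//; case: tp => ->; rewrite /p; first by rewrite opprB addrC subrK rpred_int.
    rewrite (_ : _ + _ = (Num.floor (x i 0))%:~R + 1) ?rpredD ?rpred_int ?rpred1//; ring.
  - by rewrite inE negb_or yE => /andP[/negbTE-> /zx].
  - rewrite yE; case: eqVneq => [->|_]; last exact: zx1.
    rewrite zx// [x i 0 + t]addrC addrK ler_norml.
    by case: tp => ->; apply/andP; split; lra.
  - have : c * (size s).+1%:R / 4 = c * (size s)%:R / 4 + c / 4.
      by rewrite -natr1; field.
    lra.
have : dot z (W *m z) <= dot (y (- p)) (W *m y (- p)) + c / 4 \/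
       dot z (W *m z) <= dot (y (1 - p)) (W *m y (1 - p)) + c / 4.
  have [|h1] := leP (dot z (W *m z)) (dot (y (- p)) (W *m y (- p)) + c / 4); first by left.
  have [|h2] := leP (dot z (W *m z)) (dot (y (1 - p)) (W *m y (1 - p)) + c / 4); first by right.
  exfalso; move: h1 h2; rewrite !yQ => h1 h2.
  have k1 : (1 - p) * (dot z (W *m z) + - p * L + (- p) ^+ 2 * W i i + c / 4) <
      (1 - p) * dot z (W *m z) by rewrite ltr_pM2l// subr_gt0.
  have k2 := ler_wpM2l p0 (ltW h2).
  have pp : 0 <= p * (1 - p) by rewrite mulr_ge0// subr_ge0 ltW.
  have k3 := ler_wpM2l pp (Wc i).
  have pp4 : p * (1 - p) <= 4^-1 by have := sqr_ge0 (p - 2^-1); lra.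
  have k4 := ler_wpM2l c0 pp4.
  lra.
by case=> [/good|/good]; apply; [left|right].
Qed.

End LatticeRounding.

Section LatticeForms.
Context {R : realType}.

Definition lattice_vector n (z : 'cV[R]_n) := forall i, z i 0 \is a Num.int.

(** One step of the bootstrap: the a priori bound [S] only serves to bound the
    diagonal entries from below, and these are all that rounding sees. *)
Lemma lattice_rounding_le n (W : 'M[R]_n) a S (x : 'cV[R]_n) : 0 <= a -> 0 <= S ->
  (forall z, lattice_vector z -> sqnorm2 z <= 4 * n%:R ->
    dot z (W *m z) <= a * sqnorm2 z) ->
  (forall x, - (S * sqnorm2 x) <= dot x (W *m x)) ->
  sqnorm2 x = n%:R -> dot x (W *m x) <= (5 * a + S) / 4 * sqnorm2 x.
Proof.
move=> a0 S0 Wa WS xn.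
have shift y : dot y ((W - a%:M) *m y) = dot y (W *m y) - a * sqnorm2 y.
  by rewrite mulmxBl mul_scalar_mx -scaleNr dotDr dotZr -sqnorm2_dot mulNr.
have diag i : - (S + a) <= (W - a%:M) i i.
  rewrite !mxE eqxx mulr1n opprD lerD2r.
  have := WS (delta_mx i 0); rewrite dot_delta_mulmx sqnorm2_dot.
  by rewrite -[X in dot _ X]mul1mx dot_delta_mulmx mxE eqxx mulr1.
have [z [zi zx xz]] := lattice_rounding x (addr_ge0 S0 a0) diag.
have zn : sqnorm2 z <= 4 * n%:R.
  apply: (@le_trans _ _ (\sum_i (2 * x i 0 ^+ 2 + 2))).
    apply: ler_sum => i _; have := zx i; rewrite ler_norml => /andP[h1 h2].
    have := sqr_ge0 (z i 0 - x i 0 - x i 0).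
    have : (z i 0 - x i 0) ^+ 2 <= 1 by nra.
    lra.
  rewrite big_split/= -mulr_sumr -/(sqnorm2 x) xn sumr_const card_ord -[2 *+ n]mulr_natr; lra.
have := Wa z zi zn; rewrite !shift in xz; rewrite xn in xz *; lra.
Qed.

(** Rounding errors only enter quadratically: if [S] is the supremum of the
    absolute value of the form on the unit ball, rounding a vector of squared
    norm [n] gives [S <= (5 a + S) / 4]. *)
Lemma form_le_of_lattice n (W : 'M[R]_n) a : 0 <= a -> (0 < n)%N ->
  (forall z, lattice_vector z -> sqnorm2 z <= 4 * n%:R ->
    `|dot z (W *m z)| <= a * sqnorm2 z) ->
  forall x, `|dot x (W *m x)| <= 5 / 3 * a * sqnorm2 x.
Proof.
move=> a0 n0 Wa.
pose E := [set `|dot x (W *m x)| | x in [set x : 'cV[R]_n | sqnorm2 x <= 1]].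
have scale r x : `|dot (r *: x) (W *m (r *: x))| = r ^+ 2 * `|dot x (W *m x)|.
  by rewrite -scalemxAr dotZl dotZr mulrA -expr2 normrM ger0_norm// sqr_ge0.
have E0 : E 0.
  exists 0; first by rewrite /= (eqP (_ : sqnorm2 0 == 0)) ?sqnorm2_eq0.
  by rewrite mulmx0 dotE big1 ?normr0// => i _; rewrite mxE mul0r.
have ubE : has_ubound E.
  exists (\sum_i \sum_j W i j ^+ 2 + 1) => _ [x /= x1 <-].
  set F := \sum_i _; have F0 : 0 <= F.
    by apply: sumr_ge0 => i _; apply: sumr_ge0 => j _; exact: sqr_ge0.
  have h := cauchy_schwarz x (W *m x).
  have h1 := sqnorm2_mulmx_le_frobenius W x; rewrite -/F in h1.
  have x0 := sqnorm2_ge0 x; have y0 := sqnorm2_ge0 (W *m x).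
  have h2 : sqnorm2 (W *m x) <= F.
    by apply: le_trans h1 _; rewrite ler_piMr.
  have h3 : dot x (W *m x) ^+ 2 <= F by apply: le_trans h _; apply: le_trans h2; rewrite ler_piMl.
  rewrite ler_norml; apply/andP; split.
    have := sqr_ge0 (dot x (W *m x) + 1); have := F0; nra.
  have := sqr_ge0 (dot x (W *m x) - 1); have := F0; nra.
pose S := sup E.
have S0 : 0 <= S by exact: ub_le_sup.
have WS x : `|dot x (W *m x)| <= S * sqnorm2 x.
  have [->|xn0] := eqVneq x 0.
    by rewrite mulmx0 dotE big1 ?normr0 ?mulr_ge0 ?sqnorm2_ge0// => i _; rewrite mxE mul0r.
  have x0 : 0 < sqnorm2 x by rewrite lt_neqAle sqnorm2_ge0 eq_sym sqnorm2_eq0 xn0.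
  rewrite -ler_pdivrMr//.
  have rx : (Num.sqrt (sqnorm2 x))^-1 ^+ 2 = (sqnorm2 x)^-1.
    by rewrite exprVn sqr_sqrtr// ltW.
  apply: ub_le_sup => //; exists ((Num.sqrt (sqnorm2 x))^-1 *: x).
    by rewrite /= sqnorm2Z rx mulVf// gt_eqF.
  by rewrite scale rx mulrC.
have step x : `|dot x (W *m x)| <= (5 * a + S) / 4 * sqnorm2 x.
  have [->|xn0] := eqVneq x 0.
    rewrite mulmx0 dotE big1 ?normr0 ?mulr_ge0 ?sqnorm2_ge0 ?divr_ge0 ?addr_ge0//.
      by rewrite mulr_ge0.
    by move=> i _; rewrite mxE mul0r.
  have x0 : 0 < sqnorm2 x by rewrite lt_neqAle sqnorm2_ge0 eq_sym sqnorm2_eq0 xn0.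
  pose r := Num.sqrt (n%:R / sqnorm2 x).
  have r2 : r ^+ 2 = n%:R / sqnorm2 x by rewrite sqr_sqrtr// divr_ge0// ltW.
  have r0 : 0 < r ^+ 2 by rewrite r2 divr_gt0// ltr0n.
  have rn : sqnorm2 (r *: x) = n%:R by rewrite sqnorm2Z r2 divfK// gt_eqF.
  suff : `|dot (r *: x) (W *m (r *: x))| <= (5 * a + S) / 4 * sqnorm2 (r *: x).
    by rewrite scale sqnorm2Z mulrCA ler_pM2l.
  rewrite ler_norml; apply/andP; split; last first.
    apply: lattice_rounding_le => // [z zi zn|y].
      by rewrite (le_trans (ler_norm _))// Wa.
    by have := WS y; rewrite ler_norml => /andP[].
  rewrite lerNl.
  have opp y : dot y (- W *m y) = - dot y (W *m y).
    by rewrite mulNmx -scaleN1r dotZr mulN1r.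
  rewrite -opp; apply: lattice_rounding_le => // [z zi zn|y].
    by rewrite opp; have := Wa z zi zn; rewrite ler_norml => /andP[]; rewrite lerNl.
  by rewrite opp lerN2; have := WS y; rewrite ler_norml => /andP[].
have : S <= (5 * a + S) / 4.
  apply: ge_sup => [|_ [x /= x1 <-]]; first by exists 0.
  apply: le_trans (step x) _; rewrite ler_piMr// divr_ge0// addr_ge0//.
  by rewrite mulr_ge0.
move=> Sa x; apply: le_trans (WS x) _.
by rewrite ler_wpM2r ?sqnorm2_ge0//; lra.
Qed.

End LatticeForms.

(** * From lattice vectors to the trace bound, and from there to restricted isometry *)

Section RestrictedGram.
Context {R : realType}.

Definition gram_defect M N (Phi : 'M[R]_(M, N)) (A : {set 'I_N}) :=
  (colset Phi A)^T *m colset Phi A - 1%:M.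

Definition zero_extend N (A : {set 'I_N}) : 'M[R]_(N, #|A|) := colset 1%:M A.

Lemma colset_zero_extend M N (Phi : 'M[R]_(M, N)) A :
  colset Phi A = Phi *m zero_extend A.
Proof. by rewrite /zero_extend /colset mulmx_colsub mulmx1. Qed.

Lemma zero_extendE N (A : {set 'I_N}) (v : 'cV_#|A|) i :
  (zero_extend A *m v) i 0 = \sum_j (i == enum_val j)%:R * v j 0.
Proof. by rewrite mxE; apply: eq_bigr => j _; rewrite !mxE. Qed.

Lemma zero_extend_supp N (A : {set 'I_N}) (v : 'cV_#|A|) i :
  (zero_extend A *m v) i 0 != 0 -> i \in A.
Proof.
apply: contraNT => iA; rewrite zero_extendE big1// => j _.
case: eqVneq => [ij|]; last by rewrite mul0r.
by rewrite ij enum_valP in iA.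
Qed.

Lemma sqnorm2_zero_extend N (A : {set 'I_N}) (v : 'cV_#|A|) :
  sqnorm2 (zero_extend A *m v) = sqnorm2 v.
Proof.
rewrite !sqnorm2_dot dot_mulmxl mulmxA (_ : _ *m _ = 1%:M) ?mul1mx//.
apply/matrixP => j k; rewrite !mxE (bigD1 (enum_val j))//= !mxE eqxx mul1r.
rewrite big1 ?addr0 => [|i ij]; last by rewrite !mxE (negbTE ij) mul0r.
by rewrite (inj_eq enum_val_inj).
Qed.

Lemma zero_extend_restrict N (A : {set 'I_N}) (x : 'cV[R]_N) :
  (forall i, x i 0 != 0 -> i \in A) ->
  zero_extend A *m (\col_j x (enum_val j) 0) = x.
Proof.
move=> xA; apply/matrixP => i j; rewrite ord1 zero_extendE.
under eq_bigr do rewrite mxE.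
rewrite -(big_enum_val (fun k => (i == k)%:R * x k 0)).
have [iA|iA] := boolP (i \in A).
  rewrite (bigD1 i)//= eqxx mul1r big1 ?addr0// => k /andP[_ ki].
  by rewrite eq_sym (negbTE ki) mul0r.
rewrite big1 => [|k kA]; first by apply/esym/eqP; apply: contraNT iA; exact: xA.
by case: eqVneq => [ik|]; [rewrite ik kA in iA|rewrite mul0r].
Qed.

Lemma gram_defect_sym M N (Phi : 'M[R]_(M, N)) A :
  (gram_defect Phi A)^T = gram_defect Phi A.
Proof. by rewrite /gram_defect linearB/= trmx_mul trmxK trmx1. Qed.

Lemma gram_defect_form M N (Phi : 'M[R]_(M, N)) A v :
  dot v (gram_defect Phi A *m v) =
  sqnorm2 (Phi *m (zero_extend A *m v)) - sqnorm2 (zero_extend A *m v).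
Proof.
rewrite mulmxBl mul1mx -scaleN1r dotDr dotZr mulN1r sqnorm2_zero_extend.
by rewrite -!sqnorm2_dot -mulmxA -dot_mulmxl -sqnorm2_dot colset_zero_extend mulmxA.
Qed.

Lemma powR_inv_le (t c : R) n : 0 <= t -> 0 <= c -> (0 < n)%N ->
  (t `^ n%:R^-1 <= c) = (t <= c ^+ n).
Proof.
move=> t0 c0 n0; rewrite -(@ler_pXn2r _ n)// ?nnegrE ?powR_ge0//.
by rewrite -(powR_mulrn n (powR_ge0 _ _)) -powRrM mulVf ?powRr1// pnatr_eq0 -lt0n.
Qed.

Lemma power_delta_leP M N (Phi : 'M[R]_(M, N)) K q delta :
  0 <= delta -> (0 < q)%N ->
  power_delta Phi K q <= delta <->
  forall A : {set 'I_N}, #|A| = K ->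
    \tr (gram_defect Phi A ^+ (2 * q)) <= delta ^+ (2 * q).
Proof.
move=> d0 q0.
have tr0 A : 0 <= \tr (gram_defect Phi A ^+ (2 * q)).
  rewrite trace_even_pow ?gram_defect_sym//.
  by apply: sumr_ge0 => i _; apply: sumr_ge0 => j _; exact: sqr_ge0.
have q20 : (0 < 2 * q)%N by rewrite muln_gt0.
split=> [h A AK|h].
  rewrite -powR_inv_le//; apply: le_trans h.
  by apply: (@le_bigmax_cond _ _ _ _ A); rewrite AK.
by apply: bigmax_le => // A /eqP AK; rewrite powR_inv_le// h.
Qed.

Lemma exists_superset (T : finType) (B : {set T}) k : (#|B| <= k <= #|T|)%N ->
  exists2 A : {set T}, B \subset A & #|A| = k.
Proof.
case/andP=> Bk kT; elim: k Bk kT => [|k IH] Bk kT.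
  by exists B => //; apply/eqP; rewrite -leqn0.
move: Bk; rewrite leq_eqVlt => /orP[/eqP<-|]; first by exists B.
rewrite ltnS => /IH/(_ (ltnW kT))[A BA Ak].
have /set0Pn[x] : ~: A != finset.set0.
  by rewrite -card_gt0 -(ltn_add2l #|A|) cardsC addn0 Ak.
rewrite inE => xA; exists (x |: A); last by rewrite cardsU1 xA Ak.
by rewrite (fintype.subset_trans BA)// finset.subsetUr.
Qed.

Lemma rip_of_power_delta M N (Phi : 'M[R]_(M, N)) K q delta :
  0 <= delta -> (0 < q)%N -> (K <= N)%N ->
  power_delta Phi K q <= delta -> rip Phi K delta.
Proof.
move=> d0 q0 KN /(power_delta_leP _ _ d0 q0) trA x xK.
have [A suppA AK] : exists2 A : {set 'I_N},
    [set i | x i 0 != 0]%SET \subset A & #|A| = K.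
  by apply: exists_superset; rewrite card_ord KN andbT cardsE.
have xA i : x i 0 != 0 -> i \in A.
  by move=> xi; apply: (fintype.subsetP suppA); rewrite inE.
have := form_le_of_trace d0 (gram_defect_sym Phi A) q0 (trA A AK)
  (\col_j x (enum_val j) 0).
rewrite gram_defect_form -sqnorm2_zero_extend zero_extend_restrict//.
by rewrite ler_norml => /andP[h1 h2]; apply/andP; split; lra.
Qed.

(** The factor [3 / 5] compensates for the passage from lattice vectors to all
    vectors, and [K `^ (2 q)^-1] for the [K] eigenvalues in the trace. *)
Lemma power_delta_of_lattice M N (Phi : 'M[R]_(M, N)) K q delta :
  0 < delta -> (0 < q)%N -> (0 < K)%N ->
  (forall z : 'cV[R]_N, lattice_vector z -> (nnz z <= K)%N ->
    sqnorm2 z <= 4 * K%:R -> `|sqnorm2 (Phi *m z) - sqnorm2 z| <=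
      3 / 5 * (delta / K%:R `^ (2 * q)%:R^-1) * sqnorm2 z) ->
  power_delta Phi K q <= delta.
Proof.
move=> d0 q0 K0 Phiz; apply/power_delta_leP => // [|A AK]; first exact: ltW.
have KR : 0 < K%:R `^ (2 * q)%:R^-1 :> R by rewrite powR_gt0// ltr0n.
set eps := delta / _ in Phiz.
have e0 : 0 < eps by rewrite divr_gt0.
have form v : `|dot v (gram_defect Phi A *m v)| <= eps * sqnorm2 v.
  rewrite (_ : eps = 5 / 3 * (3 / 5 * eps)); last by field.
  apply: form_le_of_lattice => [||z zi zn]; rewrite ?AK//.
    by rewrite mulr_ge0 ?ltW// divr_gt0.
  rewrite gram_defect_form -sqnorm2_zero_extend; apply: Phiz => [i||].
  - by rewrite zero_extendE rpred_sum// => j _; rewrite rpredM ?zi// natr_int.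
  - rewrite /nnz -AK; apply: subset_leq_card; apply/fintype.subsetP => i.
    by rewrite inE; exact: zero_extend_supp.
  - by rewrite sqnorm2_zero_extend -AK.
have := trace_even_pow_le q (ltW e0) (gram_defect_sym Phi A)
  (sqnorm2_mulmx_le_of_form e0 (gram_defect_sym Phi A) form).
move/le_trans; apply; rewrite AK /eps exprMn exprVn.
rewrite -(powR_mulrn (2 * q) (powR_ge0 _ _)) -powRrM mulVf; last first.
  by rewrite pnatr_eq0 -lt0n muln_gt0 q0.
by rewrite powRr1// mulrCA divff ?mulr1// pnatr_eq0 -lt0n.
Qed.

End RestrictedGram.

(** * Gaussian integrals *)

Section GaussianIntegral.
Context {R : realType}.
Local Notation leb := (@lebesgue_measure R).

Lemma ge0_integral_normal_prob (m s : R) (f : R -> \bar R) :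
  measurable_fun setT f -> (forall x, (0 <= f x)%E) ->
  (\int[normal_prob m s]_x f x = \int[leb]_x (f x * (normal_pdf m s x)%:E))%E.
Proof.
move=> mf f0; have dom := normal_prob_dominates m s.
rewrite -(Radon_Nikodym_SigmaFinite.change_of_variables dom)//.
apply: ae_eq_integral => //.
- apply: emeasurable_funM => //.
  exact: measurable_int (Radon_Nikodym_SigmaFinite.f_integrable dom).
- apply: emeasurable_funM => //.
  by apply/measurable_EFinP; exact: measurable_normal_pdf.
apply: ae_eqe_mul2l; apply: integral_ae_eq => //.
- exact: Radon_Nikodym_SigmaFinite.f_integrable dom.
- by apply/measurable_EFinP; exact: measurable_normal_pdf.
- by move=> E _ mE; rewrite -Radon_Nikodym_SigmaFinite.f_integral.
Qed.

(** The density lives on the Borel line as built from half-open intervals; the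
    identity carries its integrals over to any measure with the same values on
    the Borel sets of [R]. *)
Lemma ge0_integral_eq_normal_prob (mu : {measure set R -> \bar R}) (m s : R)
    (f : R -> \bar R) :
  (forall A, measurable A -> mu A = normal_prob m s A) ->
  measurable_fun [set: R] f -> (forall x, (0 <= f x)%E) ->
  (\int[mu]_x f x = \int[normal_prob m s]_x f x)%E.
Proof.
move=> muE mf f0.
pose idTR : measurableTypeR R -> R := idfun.
have midTR : measurable_fun setT idTR by move=> _ A mA; rewrite setTI.
pose idm : {mfun measurableTypeR R >-> R} :=
  HB.pack idTR (isMeasurableFun.Build _ _ _ _ _ midTR).
transitivity (\int[distribution (normal_prob m s) idm]_x f x)%E.
  by apply: eq_measure_integral => A mA _; exact: muE.
by rewrite ge0_integral_distribution.
Qed.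

(** Integrating a Gaussian variable out of a squared exponential in it gives
    a squared exponential in the remaining variable: complete the square. *)
Lemma integral_normal_expR_sqr (s v z u : R) :
  0 < v -> 0 < 1 + 2 * s * v * z ^+ 2 ->
  (\int[normal_prob 0%R (Num.sqrt v)]_x (expR (- s * (u + z * x) ^+ 2))%:E =
   ((Num.sqrt (1 + 2 * s * v * z ^+ 2))^-1 *
     expR (- (s / (1 + 2 * s * v * z ^+ 2)) * u ^+ 2))%:E)%E.
Proof.
set D := 1 + _ => v0 D0.
pose m := - (2 * s * u * z * v / D); pose t := Num.sqrt (v / D).
have vD : 0 < v / D by rewrite divr_gt0.
have t0 : t != 0 by rewrite gt_eqF// sqrtr_gt0.
have sv : Num.sqrt v != 0 by rewrite gt_eqF// sqrtr_gt0.
have mexp : measurable_fun setT (fun x => (expR (- s * (u + z * x) ^+ 2))).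
  apply: measurableT_comp => //; apply: measurable_funM => //.
  by apply: measurable_funX; apply: measurable_funD.
rewrite ge0_integral_normal_prob; last 2 first.
- exact/measurable_EFinP.
- by move=> x; rewrite lee_fin expR_ge0.
transitivity (\int[leb]_x (((Num.sqrt D)^-1 * expR (- (s / D) * u ^+ 2))%:E *
   (normal_pdf m t x)%:E))%E.
  apply: eq_integral => x _; rewrite -!EFinM; congr EFin.
  rewrite !normal_pdfE// /normal_peak /normal_fun.
  rewrite mulrCA -expRD [RHS]mulrACA -expRD; congr (_ * _).
    rewrite -invfM -sqrtrM ?ltW//; congr (Num.sqrt _)^-1.
    rewrite !sqr_sqrtr ?(ltW v0) ?(ltW vD)//.
    by rewrite -!mulrnAr [v / D * _]mulrAC [X in _ = D * X]mulrC mulrA divff ?mul1r// gt_eqF.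
  congr expR; rewrite !sqr_sqrtr ?(ltW v0) ?(ltW vD)// subr0 /m.
  have D0' : D != 0 by rewrite gt_eqF.
  have v0' : v != 0 by rewrite gt_eqF.
  rewrite /D in D0' *; field.
  by rewrite D0'.
apply: etrans; first apply: ge0_integralZl => //.
all: try by rewrite lee_fin mulr_ge0 ?expR_ge0.
- by apply/measurable_EFinP; exact: measurable_normal_pdf.
- by move=> x _; rewrite lee_fin normal_pdf_ge0.
- by rewrite integral_normal_pdf mule1.
Qed.

End GaussianIntegral.

(** * Integrating independent variables one at a time *)

Section Independence.
Context {R : realType} {d : measure_display} {T : measurableType d}.
Context (P : probability T R) (I : finType) (X : I -> {RV P >-> R}).

Definition box (J : {set I}) (B : I -> set R) : set T :=
  [set w | forall i, i \in J -> B i (X i w)].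

Lemma boxE J B : box J B = \bigcap_(i in [set` J]) (X i @^-1` B i).
Proof. by apply/seteqP; split => w wB i; exact: wB. Qed.

Lemma measurable_box J B : (forall i, measurable (B i)) -> measurable (box J B).
Proof.
move=> mB; rewrite boxE; apply: fin_bigcap_measurable => // i _.
rewrite -[X in measurable X]setTI; exact: measurable_funPT.
Qed.

(** Independence of the state [V] from the family [X i], [i \in J], tested on
    boxes. Stated for values in any measurable space, so that it survives when
    further variables are absorbed into the state. *)
Definition indep_of d' (D : measurableType d') (V : T -> D) (J : {set I}) :=
  forall (A : set D) (B : I -> set R), measurable A ->
    (forall i, measurable (B i)) ->
    P (V @^-1` A `&` box J B) = (P (V @^-1` A) * P (box J B))%E.

Lemma indep_of_cst d' (D : measurableType d') (V : T -> D) v J :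
  (forall w, V w = v) -> indep_of V J.
Proof.
move=> Vv A B mA mB; rewrite (_ : V = cst v); last exact/funext.
rewrite preimage_cst; case: ifPn => _.
  by rewrite setTI probability_setT mul1e.
by rewrite set0I measure0 mul0e.
Qed.

Lemma indep_of_comp d' (D : measurableType d') d'' (D' : measurableType d'')
    (V : T -> D) (h : D -> D') J :
  measurable_fun setT h -> indep_of V J -> indep_of (h \o V) J.
Proof.
move=> mh VJ A B mA mB; rewrite comp_preimage; apply: VJ => //.
by rewrite -[X in measurable X]setTI; exact: mh.
Qed.

Hypothesis indepX : mutually_independent X.

Lemma prob_box J B : (forall i, measurable (B i)) ->
  P (box J B) = (\prod_(i in J) P (X i @^-1` B i))%E.
Proof. exact: indepX. Qed.

Section Pair.
Context d' (D : measurableType d') (V : {mfun T >-> D}) (J : {set I}) (k : I).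
Hypothesis VJ : indep_of V J.
Hypothesis kJ : k \in J.

Let mpairVX : measurable_fun setT (fun w => (V w, X k w)).
Proof. exact: measurable_fun_pair. Qed.

Let pairVX_mixin := isMeasurableFun.Build _ _ _ _ _ mpairVX.
Let pairVX : {mfun T >-> (D * R)%type} := HB.pack (fun w => (V w, X k w)) pairVX_mixin.

Let pairVX_rect A B0 B : measurable A -> measurable B0 ->
  (forall i, measurable (B i)) ->
  P (pairVX @^-1` (A `*` B0) `&` box (J :\ k) B) =
  (P (V @^-1` A) * P (X k @^-1` B0) * P (box (J :\ k) B))%E.
Proof.
move=> mA mB0 mB.
pose B' i := if i == k then B0 else B i.
have mB' i : measurable (B' i) by rewrite /B'; case: ifP.
have -> : pairVX @^-1` (A `*` B0) `&` box (J :\ k) B = V @^-1` A `&` box J B'.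
  apply/seteqP; split => [w [[/= Vw Xw] wB]|w [Vw wB]].
    split => // i iJ; rewrite /B'; case: eqVneq => [->//|ik].
    by apply: wB; rewrite !inE ik.
  split; first by split => //=; have := wB k kJ; rewrite /B' eqxx.
  move=> i; rewrite !inE => /andP[ik iJ].
  by have := wB i iJ; rewrite /B' (negbTE ik).
rewrite VJ// -muleA; congr (_ * _)%E; rewrite !prob_box// (big_setD1 k kJ)/=.
congr (_ * _)%E; first by rewrite /B' eqxx.
by apply: eq_bigr => i; rewrite !inE => /andP[ik _]; rewrite /B' (negbTE ik).
Qed.

(** Product measures are determined by rectangles. *)
Let pairVX_law (C : set (D * R)) B : measurable C ->
  (forall i, measurable (B i)) ->
  P (pairVX @^-1` C `&` box (J :\ k) B) =
  ((distribution P V \x distribution P (X k)) C * P (box (J :\ k) B))%E.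
Proof.
move=> mC mB; have mE := measurable_box (J :\ k) mB.
have [E0|E0] := eqVneq (P (box (J :\ k) B)) 0%E.
  rewrite E0 mule0; apply/eqP; rewrite -measure_le0 -E0 le_measure ?inE//.
  by apply: measurableI => //; rewrite -[X in measurable X]setTI; exact: mpairVX.
have finE : P (box (J :\ k) B) \is a fin_num by exact: fin_num_measure.
pose p := fine (P (box (J :\ k) B)).
have p0 : 0 < p by rewrite fine_gt0// lt0e E0 measure_ge0 ltey_eq finE.
have pV0 : 0 <= p^-1 by rewrite invr_ge0 ltW.
pose m' := mscale (NngNum pV0) (pushforward (mrestr P mE) pairVX).
have m'E A B0 : measurable A -> measurable B0 ->
    m' mpairVX (A `*` B0) = (distribution P V A * distribution P (X k) B0)%E.
  move=> mA mB0; rewrite /m' /mscale/= /pushforward /mrestr pairVX_rect//.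
  by rewrite -(fineK finE) muleC -muleA -EFinM mulfV ?mule1// gt_eqF.
rewrite (product_measure_unique (m' := m' mpairVX) m'E)// /m' /mscale/= /pushforward /mrestr.
by rewrite -(fineK finE) -/p muleAC -EFinM mulVf ?mul1e// gt_eqF.
Qed.

(** The state may absorb the variable [X k], in any measurable way. *)
Lemma indep_of_merge d'' (D' : measurableType d'') (h : D * R -> D') :
  measurable_fun setT h ->
  indep_of (fun w => h (V w, X k w)) (J :\ k).
Proof.
move=> mh A B mA mB.
have mhA : measurable (h @^-1` A) by rewrite -[X in measurable X]setTI; exact: mh.
rewrite [X in P (X `&` _)](_ : _ = pairVX @^-1` (h @^-1` A))// pairVX_law//.
congr (_ * _)%E; have := @pairVX_law (h @^-1` A) (fun=> setT) mhA (fun=> measurableT).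
rewrite (_ : box _ _ = setT); first by rewrite setIT probability_setT mule1.
by apply/seteqP; split.
Qed.

(** Fubini: [X k] can be integrated first, against its own law. *)
Lemma indep_of_integral (f : D * R -> \bar R) : measurable_fun setT f ->
  (forall x, (0 <= f x)%E) ->
  (\int[P]_w f (V w, X k w) =
   \int[P]_w \int[distribution P (X k)]_x f (V w, x))%E.
Proof.
move=> mf f0.
transitivity (\int[distribution P V \x distribution P (X k)]_z f z)%E.
  rewrite (eq_measure_integral (distribution P pairVX)); last first.
    move=> A mA _; have := @pairVX_law A (fun=> setT) mA (fun=> measurableT).
    rewrite (_ : box _ _ = setT); last by apply/seteqP; split.
    by rewrite setIT probability_setT mule1 => /esym.
  by rewrite ge0_integral_distribution.
rewrite fubini_tonelli1// ge0_integral_distribution//.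
- exact: measurable_fun_fubini_tonelli_F.
- by move=> y; exact: integral_ge0.
Qed.

End Pair.

End Independence.

Section GaussianSums.
Context {R : realType} {d : measure_display} {T : measurableType d}.
Context (P : probability T R) (I : finType) (X : I -> {RV P >-> R}) (v : R).
Hypothesis indepX : mutually_independent X.
Hypothesis v0 : 0 < v.
Hypothesis gaussX : forall k, gaussian_rv (X k) 0 v.

(** The weight [W] carries the factors of the rows already processed, [U] the
    partial sum of the current row. *)
Lemma integral_gauss_step (W U : T -> R) J k z s :
  measurable_fun setT W -> measurable_fun setT U -> (forall w, 0 <= W w) ->
  indep_of X (fun w => (W w, U w)) J -> k \in J ->
  0 < 1 + 2 * s * v * z ^+ 2 ->
  (\int[P]_w (W w * expR (- s * (U w + z * X k w) ^+ 2))%:E =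
   ((Num.sqrt (1 + 2 * s * v * z ^+ 2))^-1)%:E *
   \int[P]_w (W w * expR (- (s / (1 + 2 * s * v * z ^+ 2)) * U w ^+ 2))%:E)%E.
Proof.
set D := 1 + _ => mW mU W0 WUJ kJ D0.
have mV : measurable_fun setT (fun w => (W w, U w)) by exact: measurable_fun_pair.
pose V : {mfun T >-> (R * R)%type} :=
  HB.pack (fun w => (W w, U w)) (isMeasurableFun.Build _ _ _ _ _ mV).
(* The absolute value makes the integrand nonnegative off the range of [W]. *)
pose f (p : R * R * R) := (`|p.1.1| * expR (- s * (p.1.2 + z * p.2) ^+ 2))%:E.
have mf : measurable_fun setT f.
  apply/measurable_EFinP; apply: measurable_funM.
    apply: measurableT_comp => //.
    by apply: (measurableT_comp (f := fst)) => //; exact: measurable_fst.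
  apply: measurableT_comp => //; apply: measurable_funM => //.
  apply: measurable_funX; apply: measurable_funD.
    by apply: (measurableT_comp (f := snd)) => //; exact: measurable_fst.
  by apply: measurable_funM => //; exact: measurable_snd.
have f0 p : (0 <= f p)%E by rewrite lee_fin mulr_ge0 ?expR_ge0.
have mexp c : measurable_fun setT (fun x : R => (expR (- s * (c + z * x) ^+ 2))).
  apply: measurableT_comp => //; apply: measurable_funM => //.
  by apply: measurable_funX; apply: measurable_funD.
transitivity (\int[P]_w f (V w, X k w))%E.
  by apply: eq_integral => w _; rewrite /f/= ger0_norm.
rewrite (indep_of_integral indepX (V := V) WUJ kJ)//.
rewrite -ge0_integralZl//; last 2 first.
- apply/measurable_EFinP; apply: measurable_funM => //.
  apply: measurableT_comp => //; apply: measurable_funM => //.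
  exact: measurable_funX.
- by move=> w _; rewrite lee_fin mulr_ge0 ?expR_ge0.
apply: eq_integral => w _; rewrite /f/= ger0_norm//.
transitivity (\int[normal_prob 0%R (Num.sqrt v)]_x
    (W w * expR (- s * (U w + z * x) ^+ 2))%:E)%E.
  apply: ge0_integral_eq_normal_prob => [||x].
  - by move=> A mA; exact: gaussX.
  - by apply/measurable_EFinP; apply: measurable_funM => //.
  - by rewrite lee_fin mulr_ge0 ?expR_ge0.
under eq_integral do rewrite EFinM.
rewrite ge0_integralZl//; last 2 first.
- by apply/measurable_EFinP; exact: mexp.
- by rewrite lee_fin.
by rewrite integral_normal_expR_sqr// -!EFinM mulrCA.
Qed.

Definition linear_form (z : I -> R) (r : seq I) (w : T) : R :=
  \sum_(k <- r) z k * X k w.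

Lemma measurable_linear_form z r : measurable_fun setT (linear_form z r).
Proof. by apply: measurable_sum => k; exact: measurable_funM. Qed.

Lemma indep_of_linear_form (W U : T -> R) J z r :
  measurable_fun setT W -> measurable_fun setT U ->
  indep_of X (fun w => (W w, U w)) J -> uniq r -> {subset r <= J} ->
  indep_of X (fun w => (W w, U w + linear_form z r w))
    [set k in J | k \notin r]%SET.
Proof.
move=> mW; elim: r J U => [|k r IH] J U mU WUJ /= => [_ _|/andP[kr ur] rJ].
  rewrite (_ : [set k in J | _]%SET = J); last by apply/setP => k; rewrite !inE andbT.
  rewrite (_ : (fun w => _) = (fun w => (W w, U w)))//.
  by apply/funext => w; rewrite /linear_form big_nil addr0.
have mV : measurable_fun setT (fun w => (W w, U w)) by exact: measurable_fun_pair.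
pose V : {mfun T >-> (R * R)%type} :=
  HB.pack (fun w => (W w, U w)) (isMeasurableFun.Build _ _ _ _ _ mV).
have kJ : k \in J by apply: rJ; rewrite inE eqxx.
have mUk : measurable_fun setT (fun w => U w + z k * X k w).
  by apply: measurable_funD => //; exact: measurable_funM.
have mh : measurable_fun setT (fun p : R * R * R => (p.1.1, p.1.2 + z k * p.2)).
  apply: measurable_fun_pair.
    by apply: (measurableT_comp (f := fst)) => //; exact: measurable_fst.
  apply: measurable_funD.
    by apply: (measurableT_comp (f := snd)) => //; exact: measurable_fst.
  by apply: measurable_funM => //; exact: measurable_snd.
have := IH (J :\ k) (fun w => U w + z k * X k w) mUk
  (indep_of_merge indepX (V := V) WUJ kJ mh) ur.
rewrite (_ : [set j in J | _]%SET = [set j in J :\ k | j \notin r]%SET); last first.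
  by apply/setP => j; rewrite !inE negb_or; case: (j == k); rewrite ?andbF.
rewrite (_ : (fun w => (W w, U w + linear_form z (k :: r) w)) =
  (fun w => (W w, U w + z k * X k w + linear_form z r w))); last first.
  by apply/funext => w; rewrite /linear_form big_cons addrA.
apply=> j jr; rewrite !inE rJ ?inE ?jr ?orbT// andbT.
by apply: contraNneq kr => <-.
Qed.

(** Induction on [r] from its last variable: each integration replaces [s] by
    [s / (1 + 2 s v (z k)^2)], and these denominators telescope to
    [1 + 2 s v \sum_k (z k)^2], which decides whether the integral is finite
    when [s < 0]. *)
Lemma integral_expR_sqr_linear_form (W U : T -> R) J z r s :
  measurable_fun setT W -> measurable_fun setT U -> (forall w, 0 <= W w) ->
  indep_of X (fun w => (W w, U w)) J -> uniq r -> {subset r <= J} ->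
  0 < 1 + 2 * s * v * \sum_(k <- r) z k ^+ 2 ->
  (\int[P]_w (W w * expR (- s * (U w + linear_form z r w) ^+ 2))%:E =
   ((Num.sqrt (1 + 2 * s * v * \sum_(k <- r) z k ^+ 2))^-1)%:E *
   \int[P]_w (W w * expR (- (s / (1 + 2 * s * v * \sum_(k <- r) z k ^+ 2)) *
                              U w ^+ 2))%:E)%E.
Proof.
move=> mW + W0; elim: r J U => [|k r IH] J U mU WUJ /= => [_ _ _|/andP[kr ur] rJ].
  rewrite big_nil mulr0 addr0 sqrtr1 invr1 mul1e mulr1.
  by apply: eq_integral => w _; rewrite /linear_form big_nil addr0.
rewrite big_cons; set S := \sum_(j <- r) _; set D' := 1 + _ => D'0.
have S0 : 0 <= S by apply: sumr_ge0 => i _; exact: sqr_ge0.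
pose D := 1 + 2 * s * v * S.
have D0 : 0 < D.
  have [s0|s0] := leP 0 s.
    by have := mulr_ge0 (mulr_ge0 s0 (ltW v0)) S0; rewrite /D; lra.
  have := mulr_ge0 (mulr_ge0 (ltW v0) (sqr_ge0 (z k))) (_ : 0 <= - s).
  by rewrite oppr_ge0 ltW// => /(_ isT); move: D'0; rewrite /D /D'; lra.
have DD : D' = D * (1 + 2 * (s / D) * v * z k ^+ 2).
  by rewrite /D' /D; field; rewrite gt_eqF.
have kJ : k \in J by apply: rJ; rewrite inE eqxx.
have mUk : measurable_fun setT (fun w => U w + z k * X k w).
  by apply: measurable_funD => //; exact: measurable_funM.
have indk : indep_of X (fun w => (W w, U w + z k * X k w)) (J :\ k).
  have := @indep_of_linear_form W U J z [:: k] mW mU WUJ isT.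
  rewrite (_ : [set j in J | _]%SET = J :\ k); last first.
    by apply/setP => j; rewrite !inE andbC.
  rewrite (_ : (fun w => (W w, U w + linear_form z [:: k] w)) =
    (fun w => (W w, U w + z k * X k w))); last first.
    by apply/funext => w; rewrite /linear_form big_seq1.
  by apply=> j; rewrite inE => /eqP->.
have step0 : 0 < 1 + 2 * (s / D) * v * z k ^+ 2 by rewrite DD pmulr_rgt0 in D'0.
transitivity (\int[P]_w (W w * expR (- s * ((U w + z k * X k w) + linear_form z r w) ^+ 2))%:E)%E.
  by apply: eq_integral => w _; rewrite /linear_form big_cons addrA.
rewrite (IH _ _ mUk indk ur)//; last first.
  move=> j jr; rewrite !inE rJ ?inE ?jr ?orbT// andbT.
  by apply: contraNneq kr => <-.
rewrite (integral_gauss_step mW mU W0 WUJ kJ step0) muleA -EFinM.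
by rewrite -invfM -sqrtrM ?(ltW D0)// -DD -[s / D / _]mulrA -invfM -DD.
Qed.

End GaussianSums.

(** * Elementary bounds on the exponential *)

Section ExponentialBounds.
Context {R : realType}.

Lemma expR_ge_bernoulli (x : R) n : - n.+1%:R <= x -> (1 + x / n.+1%:R) ^+ n.+1 <= expR x.
Proof.
move=> nx; rewrite -[x in leRHS](@divfK _ n.+1%:R) ?pnatr_eq0//.
rewrite expRM_natr lerXn2r ?nnegrE ?expR_ge0 ?expR_ge1Dx//.
by rewrite -lerBlDl sub0r lter_pdivlMr// mulN1r.
Qed.

(** The second-order loss [b ^+ 2 / 4] is what makes the tails sub-Gaussian;
    for [b > 0] it is valid only on a bounded range, and [3 / 5] is the largest
    relative error in use. *)
Lemma oneD_le_expR (b : R) : - 1 <= b -> b <= 3 / 5 ->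
  1 + b <= expR (b - b ^+ 2 / 4).
Proof.
move=> b1 b2; have [b0|b0] := leP 0 b.
  have h := @expR_ge_bernoulli (b - b ^+ 2 / 4) 3.
  apply: le_trans (h _); last by nra.
  pose t := b - b ^+ 2 / 4.
  have t0 : 0 <= t by rewrite /t; nra.
  have tt : (17 / 20 * b) ^+ 2 <= t ^+ 2.
    by rewrite lerXn2r ?nnegrE//; [lra|rewrite /t; nra].
  apply: (@le_trans _ _ (1 + t + 3 / 8 * t ^+ 2)); first by rewrite /t in tt *; nra.
  rewrite -/t !exprS expr0; nra.
have h := @expR_ge_bernoulli (b - b ^+ 2 / 4) 1.
apply: le_trans (h _); nra.
Qed.

End ExponentialBounds.

(** * Concentration at a single vector *)

Section GaussianMatrix.
Context {R : realType} {d : measure_display} {T : measurableType d}.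
Context (P : probability T R) (M N : nat) (X : 'I_M * 'I_N -> {RV P >-> R}).

Definition row_form (z : 'cV[R]_N) (i : 'I_M) (w : T) : R :=
  linear_form X (fun k => z k.2 0) [seq (i, j) | j <- enum 'I_N] w.

Lemma sqnorm2_matrix_at z w :
  sqnorm2 (matrix_at X w *m z) = \sum_i row_form z i w ^+ 2.
Proof.
apply: eq_bigr => i _; congr (_ ^+ 2); rewrite mxE /row_form /linear_form.
by rewrite big_map big_enum; apply: eq_bigr => j _; rewrite mxE mulrC.
Qed.

Lemma measurable_sqnorm2_matrix_at z :
  measurable_fun setT (fun w => sqnorm2 (matrix_at X w *m z)).
Proof.
under eq_fun do rewrite sqnorm2_matrix_at.
apply: measurable_sum => i; apply: measurable_funX.
exact: measurable_linear_form.
Qed.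

Hypothesis M0 : (0 < M)%N.
Hypothesis gaussX : gaussian_matrix X.

(** Each row contributes the same factor: once integrated, it is absorbed into
    the weight [W]. *)
Lemma integral_expR_rows (rs : seq 'I_M) (W : T -> R) J z s :
  0 < 1 + 2 * s * M%:R^-1 * sqnorm2 z ->
  measurable_fun setT W -> (forall w, 0 <= W w) ->
  indep_of X (fun w => (W w, 0 : R)) J -> uniq rs ->
  (forall i j, i \in rs -> (i, j) \in J) ->
  (\int[P]_w (W w * expR (- s * \sum_(i <- rs) row_form z i w ^+ 2))%:E =
  ((Num.sqrt (1 + 2 * s * M%:R^-1 * sqnorm2 z))^-1 ^+ size rs)%:E *
   \int[P]_w (W w)%:E)%E.
Proof.
have [indepX gX] := gaussX.
have v0 : 0 < M%:R^-1 :> R by rewrite invr_gt0 ltr0n.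
move=> D0; elim: rs W J => [|i rs IH] W J mW W0 WJ /= => [_ _|/andP[irs urs] rsJ].
  rewrite expr0 mul1e; apply: eq_integral => w _.
  by rewrite big_nil mulr0 expR0 mulr1.
pose r := [seq (i, j) | j <- enum 'I_N].
have ur : uniq r by rewrite map_inj_uniq ?enum_uniq// => j k [].
have rJ : {subset r <= J} by move=> _ /mapP[j _ ->]; apply: rsJ; rewrite inE eqxx.
have zr : \sum_(k <- r) z k.2 0 ^+ 2 = sqnorm2 z by rewrite big_map big_enum.
have mh : measurable_fun setT
    (fun p : R * R => (p.1 * expR (- s * p.2 ^+ 2), 0 : R)).
  apply: measurable_fun_pair => //; apply: measurable_funM.
    exact: measurable_fst.
  apply: measurableT_comp => //; apply: measurable_funM => //.
  by apply: measurable_funX; exact: measurable_snd.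
have mrow : measurable_fun setT (row_form z i) by exact: measurable_linear_form.
have indi := indep_of_comp mh (indep_of_linear_form indepX
  (fun k => z k.2 0) mW (measurable_cst (0 : R)) WJ ur rJ).
rewrite (_ : _ \o _ = fun w => (W w * expR (- s * row_form z i w ^+ 2), 0)) in indi;
  last by apply/funext => w /=; rewrite add0r.
transitivity (\int[P]_w ((W w * expR (- s * row_form z i w ^+ 2)) *
    expR (- s * \sum_(i <- rs) row_form z i w ^+ 2))%:E)%E.
  by apply: eq_integral => w _; rewrite big_cons mulrDr expRD mulrA.
rewrite (IH _ _ _ _ indi urs); last 3 first.
- apply: measurable_funM => //; apply: measurableT_comp => //.
  by apply: measurable_funM => //; exact: measurable_funX.
- by move=> w; rewrite mulr_ge0 ?expR_ge0.
- move=> k j kr; rewrite inE rsJ ?inE ?kr ?orbT//=.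
  by apply/mapP => -[j' _ [ki _]]; rewrite -ki kr in irs.
have := integral_expR_sqr_linear_form indepX v0 gX (U := cst 0)
  (z := fun k => z k.2 0) (s := s) mW (measurable_cst (0 : R)) W0 WJ ur rJ.
rewrite zr => /(_ D0) h.
rewrite exprSr EFinM -muleA; congr (_ * _)%E.
rewrite [X in (_ * X)%E](_ : _ = (\int[P]_w (W w * expR (- (s /
    (1 + 2 * s * M%:R^-1 * sqnorm2 z)) * cst 0 w ^+ 2))%:E)%E).
  by rewrite -h; apply: eq_integral => w _; rewrite /= add0r.
by apply: eq_integral => w _; rewrite /= expr0n/= mulr0 expR0 mulr1.
Qed.

Lemma integral_expR_sqnorm2 z s :
  0 < 1 + 2 * s * M%:R^-1 * sqnorm2 z ->
  (\int[P]_w (expR (- s * sqnorm2 (matrix_at X w *m z)))%:E =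
  ((Num.sqrt (1 + 2 * s * M%:R^-1 * sqnorm2 z))^-1 ^+ M)%:E)%E.
Proof.
move=> D0.
have ind1 : indep_of X (fun w => (cst 1 w : R, 0 : R)) [set: 'I_M * 'I_N]%SET.
  exact: (@indep_of_cst _ _ _ _ _ X _ (R * R)%type (fun=> (1, 0)) (1, 0) _
    (fun=> erefl)).
have int1 : (\int[P]_w (cst 1 w)%:E = 1 :> \bar R)%E.
  by rewrite (integral_cst P measurableT 1%E) mul1e; exact: probability_setT.
have := @integral_expR_rows (enum 'I_M) (cst 1) [set: 'I_M * 'I_N]%SET z s D0
  (measurable_cst _) (fun=> ler01) ind1 (enum_uniq _).
rewrite size_enum_ord int1 mule1 => <-.
  by apply: eq_integral => w _; rewrite sqnorm2_matrix_at big_enum/= mul1r.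
by move=> i j _; rewrite inE.
Qed.

(** Exponential Markov inequality; [b > 0] gives the upper tail, [b < 0] the
    lower one, and the exponent is optimal in both cases. *)
Lemma chi_square_tail (z : 'cV[R]_N) (b : R) : - 1 < b -> 0 < sqnorm2 z ->
  (P [set w | 0 <= b * (sqnorm2 (matrix_at X w *m z) - (1 + b) * sqnorm2 z)]%R <=
   ((Num.sqrt (1 + b) * expR (- b / 2)) ^+ M)%:E)%E.
Proof.
move=> b1; set y := sqnorm2 z => y0.
have b10 : 0 < 1 + b by lra.
have MR0 : 0 < M%:R :> R by rewrite ltr0n.
pose Z w := b * (sqnorm2 (matrix_at X w *m z) - (1 + b) * y).
have mZ : measurable_fun setT Z.
  apply: measurable_funM => //; apply: measurable_funB => //.
  exact: measurable_sqnorm2_matrix_at.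
pose ZZ : {RV P >-> R} := HB.pack Z (isMeasurableFun.Build _ _ _ _ _ mZ).
pose r := M%:R / (2 * y * (1 + b)).
have r0 : 0 < r by rewrite divr_gt0 ?mulr_gt0.
have := chernoff ZZ 0 r0; rewrite mulr0 oppr0 expR0 mule1 => /le_trans; apply.
rewrite /mmt_gen_fun unlock/=.
pose s := - (r * b).
have sy : 1 + 2 * s * M%:R^-1 * y = (1 + b)^-1.
  by rewrite /s /r; field; rewrite !gt_eqF.
have := @integral_expR_sqnorm2 z s; rewrite -/y sy invr_gt0 => /(_ b10) h.
rewrite (eq_integral (fun w => ((expR (- (b / 2)) ^+ M)%:E *
    (expR (- s * sqnorm2 (matrix_at X w *m z)))%:E)%E)); last first.
  move=> w _; rewrite -EFinM -expRM_natr -expRD; congr (expR _)%:E.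
  by rewrite /Z /s /r; field; rewrite !gt_eqF.
rewrite ge0_integralZl//; last first.
  apply/measurable_EFinP; apply: measurableT_comp => //.
  by apply: measurable_funM => //; exact: measurable_sqnorm2_matrix_at.
by rewrite h -EFinM lee_fin sqrtrV ?(ltW b10)// invrK -exprMn mulrC mulNr.
Qed.

Lemma chi_square_concentration (z : 'cV[R]_N) (a : R) :
  0 < a -> a <= 3 / 5 -> 0 < sqnorm2 z ->
  (P [set w | a * sqnorm2 z <= `|sqnorm2 (matrix_at X w *m z) - sqnorm2 z|]%R <=
   (2 * expR (- (a ^+ 2 / 8 * M%:R)))%:E)%E.
Proof.
move=> a0 a1 y0; set y := sqnorm2 z in y0 *.
pose tail b := [set w | 0 <= b * (sqnorm2 (matrix_at X w *m z) - (1 + b) * y)].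
have tail_le b : - 1 < b -> b <= 3 / 5 ->
    (P (tail b) <= (expR (- (b ^+ 2 / 8 * M%:R)))%:E)%E.
  move=> b1 b2; apply: le_trans (chi_square_tail b1 y0) _.
  rewrite lee_fin -mulNr expRM_natr lerXn2r ?nnegrE ?mulr_ge0 ?expR_ge0//.
  have -> : - (b ^+ 2 / 8) = (b - b ^+ 2 / 4) / 2 + - b / 2 by field.
  rewrite expRD ler_wpM2r ?expR_ge0//.
  rewrite -[leRHS]ger0_norm ?expR_ge0// -sqrtr_sqr ler_wsqrtr//.
  rewrite -expRM_natl mulrC divfK//.
  by apply: oneD_le_expR => //; exact: ltW.
have mT := measurable_sqnorm2_matrix_at z.
have mtail b : measurable (tail b).
  rewrite -[tail b]setTI; apply: measurable_fun_le => //.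
  by apply: measurable_funM => //; exact: measurable_funB.
have ma : measurable [set w | a * y <= `|sqnorm2 (matrix_at X w *m z) - y|].
  rewrite -[X in measurable X]setTI; apply: measurable_fun_le => //.
  by apply: measurableT_comp => //; exact: measurable_funB.
apply: (@le_trans _ _ (P (tail a `|` tail (- a)))).
  apply: le_measure; rewrite ?inE//; first exact: measurableU.
  move=> w /=; rewrite ler_normr => /orP[h|h]; [left|right]; rewrite /tail/=.
    by apply: mulr_ge0; [exact: ltW|lra].
  by rewrite -mulrNN opprK; apply: mulr_ge0; [exact: ltW|lra].
apply: le_trans (measureU2 _ _ _) _ => //.
rewrite mulr_natl mulr2n EFinD; apply: leeD; first by apply: tail_le; lra.
by rewrite -[a ^+ 2]sqrrN; apply: tail_le; lra.
Qed.

End GaussianMatrix.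

(** * Counting sparse lattice points *)

Section LatticeCount.
Context {R : realType}.

(** The integer coordinates of absolute value at most [B], with [None] for zero. *)
Definition letter B := option (bool * 'I_B).

Definition letter_val B (c : letter B) : R :=
  if c is Some (b, m) then (-1) ^+ b * m.+1%:R else 0.

Definition letter_sq B (c : letter B) : nat :=
  if c is Some (_, m) then m.+1 ^ 2 else 0.

Definition word N B := {ffun 'I_N -> letter B}.

Definition word_vec N B (f : word N B) : 'cV[R]_N := \col_i letter_val (f i).

Lemma letter_val_sq B (c : letter B) : letter_val c ^+ 2 = (letter_sq c)%:R.
Proof.
case: c => [[b m]|]/=; last by rewrite expr0n.
by rewrite exprMn sqrr_sign mul1r natrX.
Qed.

Lemma letter_val_eq0 B (c : letter B) : (letter_val c == 0) = (c == None).
Proof.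
case: c => [[b m]|]/=; last by rewrite !eqxx.
by rewrite mulf_eq0 signr_eq0 pnatr_eq0.
Qed.

Lemma sqnorm2_word N B (f : word N B) :
  sqnorm2 (word_vec f) = (\sum_i letter_sq (f i))%:R.
Proof.
by rewrite natr_sum; apply: eq_bigr => i _; rewrite mxE letter_val_sq.
Qed.

Lemma nnz_word N B (f : word N B) : nnz (word_vec f) = (\sum_i (f i != None))%N.
Proof.
rewrite /nnz -sum1_card big_mkcond/=; apply: eq_bigr => i _.
by rewrite inE mxE letter_val_eq0; case: (f i == None).
Qed.

Lemma lattice_vector_word N B (z : 'cV[R]_N) : lattice_vector z ->
  sqnorm2 z <= B%:R ^+ 2 -> exists f : word N B, z = word_vec f.
Proof.
move=> zi zB.
have lz i : exists c : letter B, z i 0 = letter_val c.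
  have /intrP[m zm] := zi i.
  have mB : (`|m| <= B)%N.
    rewrite -(ler_nat R) natr_absz intr_norm -zm.
    rewrite -(@ler_pXn2r _ 2)// ?nnegrE// real_normK ?num_real//.
    apply: le_trans zB; rewrite /sqnorm2 (bigD1 i)//= lerDl.
    by apply: sumr_ge0 => j _; exact: sqr_ge0.
  rewrite zm; case: m mB {zm} => [[|m]|m] /= mB.
  - by exists None.
  - by exists (Some (false, Ordinal mB)); rewrite /= expr0 mul1r.
  - by exists (Some (true, Ordinal mB)); rewrite /= expr1 mulN1r NegzE mulrNz.
pose f : word N B := [ffun i => sval (cid (lz i))].
exists f; apply/matrixP => i j; rewrite ord1 mxE ffunE.
by case: (cid (lz i)).
Qed.

Lemma geometric_sum_le (x : R) n : 0 <= x -> x < 1 ->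
  \sum_(m < n) x ^+ m <= (1 - x)^-1.
Proof.
move=> x0 x1; have x1' : 0 < 1 - x by rewrite subr_gt0.
rewrite -[leRHS]mul1r ler_pdivlMr// mulrC -opprB mulNr -subrX1 opprB.
by rewrite lerBlDr lerDl exprn_ge0.
Qed.

Lemma sum_letter_weight B (t r : R) : 0 <= t -> 0 <= r -> r < 1 ->
  \sum_(c : letter B) t ^+ (c != None) * r ^+ letter_sq c
    <= 1 + t * (2 * (r / (1 - r ^+ 3))).
Proof.
move=> t0 r0 r1; rewrite (bigD1 None)//= !expr0 mulr1 lerD2l.
rewrite (reindex_omap Some id)/=; last by case.
rewrite (eq_bigr (fun p : bool * 'I_B => t * r ^+ (p.2.+1 ^ 2))); last first.
  by case=> b m _; rewrite expr1.
rewrite (eq_bigl predT); last by move=> p; rewrite eqxx.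
rewrite -(pair_bigA _ (fun (_ : bool) (m : 'I_B) => t * r ^+ (m.+1 ^ 2)))/= big_bool/= -mulr_sumr.
rewrite -mulr2n -mulrnAr -[X in t * X]mulr_natl.
rewrite ler_wpM2l// ler_wpM2l//.
apply: (@le_trans _ _ (r * \sum_(m < B) (r ^+ 3) ^+ m)).
  rewrite mulr_sumr; apply: ler_sum => m _; rewrite -exprM -exprS.
  by rewrite ler_wiXn2l ?(ltW r1)//; nia.
rewrite ler_wpM2l// geometric_sum_le ?exprn_ge0//.
by rewrite exprn_ilt1.
Qed.

(** Weight a word by [t ^+ nnz * r ^+ sqnorm2]. Admissible words weigh at least
    [t ^+ K * r ^+ (4 K)], while the total weight is a product over
    coordinates. *)
Lemma card_words_le N B K (t r : R) : 0 < t -> t <= 1 -> 0 < r -> r < 1 ->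
  #|[pred f : word N B | (nnz (word_vec f) <= K)%N &&
                         (sqnorm2 (word_vec f) <= 4 * K%:R)]|%:R
    <= (1 + t * (2 * (r / (1 - r ^+ 3)))) ^+ N / (t ^+ K * r ^+ (4 * K)).
Proof.
move=> t0 t1 r0 r1.
rewrite ler_pdivlMr ?mulr_gt0 ?exprn_gt0// -sum1_card natr_sum mulr_suml.
pose wt (f : word N B) := \prod_i (t ^+ (f i != None) * r ^+ letter_sq (f i)).
have wtE f : wt f = t ^+ (\sum_i (f i != None)) * r ^+ (\sum_i letter_sq (f i)).
  by rewrite /wt big_split/= -!expr_sum.
apply: (@le_trans _ _ (\sum_f wt f)).
  rewrite big_mkcond/=; apply: ler_sum => f _.
  case: ifPn => [/andP[fK f4]|_]; last first.
    by rewrite wtE mulr_ge0// exprn_ge0// ltW.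
  rewrite mul1r wtE ler_pM ?exprn_ge0 ?(ltW t0) ?(ltW r0)//.
    by rewrite -nnz_word ler_wiXn2l ?(ltW t0).
  rewrite ler_wiXn2l ?(ltW r0) ?(ltW r1)// -(ler_nat R) -sqnorm2_word natrM.
  exact: f4.
rewrite /wt -(bigA_distr_bigA (fun=> fun c : letter B =>
  t ^+ (c != None) * r ^+ letter_sq c))/= prodr_const card_ord.
apply: lerXn2r; rewrite ?nnegrE.
- by apply: sumr_ge0 => c _; rewrite mulr_ge0 ?exprn_ge0 ?ltW.
- rewrite addr_ge0// mulr_ge0 ?ltW// mulr_gt0// divr_gt0// subr_gt0.
  by rewrite exprn_ilt1// ltW.
- by apply: sum_letter_weight => //; exact: ltW.
Qed.

(** With [r = 4 / 5] the lattice points cost a factor [e ^ (5 / 2)] per nonzero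
    coordinate, and [t = 10 K / (33 N)] reproduces the usual bound
    [(e N / K) ^ K] on the number of supports. *)
Lemma card_words_le_expR N B K : (0 < K)%N -> (K <= N)%N ->
  #|[pred f : word N B | (nnz (word_vec f) <= K)%N &&
                         (sqnorm2 (word_vec f) <= 4 * K%:R)]|%:R
    <= expR (5 / 2 * K%:R + K%:R * ln (expR 1 * N%:R / K%:R)) :> R.
Proof.
move=> K0 KN; have N0 : (0 < N)%N by exact: leq_trans KN.
have KR : 0 < K%:R :> R by rewrite ltr0n.
have NR : 0 < N%:R :> R by rewrite ltr0n.
have KNR : K%:R <= N%:R :> R by rewrite ler_nat.
pose t : R := 10 / 33 * (K%:R / N%:R); pose r : R := 4 / 5.
have t0 : 0 < t by rewrite mulr_gt0 ?divr_gt0.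
have kn1 : K%:R / N%:R <= 1 :> R by rewrite ler_pdivrMr// mul1r.
have t1 : t <= 1 by rewrite /t; lra.
have r0 : 0 < r by rewrite divr_gt0.
have r1 : r < 1 by rewrite /r; lra.
apply: le_trans (card_words_le N B K t0 t1 r0 r1) _.
rewrite ler_pdivrMr ?mulr_gt0 ?exprn_gt0//.
apply: (@le_trans _ _ (expR K%:R)).
  rewrite -[X in expR X](@divfK _ N%:R) ?gt_eqF// expRM_natr lerXn2r ?nnegrE ?expR_ge0//.
    rewrite addr_ge0// mulr_ge0 ?ltW// mulr_gt0// divr_gt0// subr_gt0.
    by rewrite exprn_ilt1// ltW.
  apply: le_trans (expR_ge1Dx _); rewrite lerD2l.
  have -> : 2 * (r / (1 - r ^+ 3)) = 200 / 61 by rewrite /r; field.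
  by have := ltW (divr_gt0 KR NR); rewrite /t; lra.
(* [(1 + 1 / 10) ^ 25] is a rational lower bound for [e ^ (5 / 2)]. *)
have e52 : 33 / 10 / r ^+ 4 <= expR (5 / 2) :> R.
  apply: le_trans (@expR_ge_bernoulli R (5 / 2) 24 _); last by lra.
  have -> : 1 + 5 / 2 / 25 = 11 / 10 :> R by lra.
  have -> : (11 / 10) ^+ 25 = (11 / 10) ^+ 5 ^+ 5 :> R by rewrite -exprM.
  apply: (@le_trans _ _ ((8 / 5) ^+ 5)); first by rewrite /r; lra.
  by rewrite lerXn2r ?nnegrE; lra.
have eNK : 0 < expR 1 * N%:R / K%:R :> R by rewrite divr_gt0 ?mulr_gt0 ?expR_gt0.
rewrite expRD expRM_natr [K%:R * ln _]mulrC expRM_natr lnK ?posrE//.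
rewrite -[K%:R in leLHS]mul1r expRM_natr exprM -!exprMn.
rewrite lerXn2r ?nnegrE ?mulr_ge0 ?expR_ge0 ?invr_ge0 ?exprn_ge0 ?(ltW r0) ?(ltW t0)//.
have -> : expR (5 / 2) * (expR 1 * N%:R / K%:R) * (t * r ^+ 4) =
   expR 1 * (expR (5 / 2) / (33 / 10 / r ^+ 4)).
  by rewrite /t; field; rewrite !gt_eqF.
by rewrite ler_peMr ?expR_ge0// ler_pdivlMr ?mul1r// divr_gt0 ?exprn_gt0.
Qed.

End LatticeCount.

(** * Measurability of the trace event *)

Section MeasurableMatrices.
Context {R : realType} {d : measure_display} {T : measurableType d}.

Definition measurable_mx m n (F : T -> 'M[R]_(m, n)) :=
  forall i j, measurable_fun setT (fun w => F w i j).

Lemma measurable_mulmx m n p (F : T -> 'M[R]_(m, n)) (G : T -> 'M[R]_(n, p)) :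
  measurable_mx F -> measurable_mx G -> measurable_mx (fun w => F w *m G w).
Proof.
move=> mF mG i j; under eq_fun do rewrite mxE.
by apply: measurable_sum => k; exact: measurable_funM.
Qed.

Lemma measurable_mx_exp n (F : T -> 'M[R]_n) k :
  measurable_mx F -> measurable_mx (fun w => F w ^+ k).
Proof.
move=> mF; elim: k => [|k IH] i j; first exact: measurable_cst.
under eq_fun do rewrite exprS; exact: measurable_mulmx.
Qed.

Lemma measurable_trace_gram_defect (P : probability T R) M N
    (X : 'I_M * 'I_N -> {RV P >-> R}) (A : {set 'I_N}) k :
  measurable_fun setT (fun w => \tr (gram_defect (matrix_at X w) A ^+ k)).
Proof.
apply: measurable_sum => i; apply: measurable_mx_exp => {}i j.
have mcol : measurable_mx (fun w => colset (matrix_at X w) A).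
  move=> a b; under eq_fun do rewrite !mxE; exact: measurable_funPT.
under eq_fun do rewrite mxE [X in _ + X]mxE.
apply: measurable_funD; last exact: measurable_cst.
apply: measurable_mulmx => // a b.
by under eq_fun do rewrite mxE; exact: mcol.
Qed.

Lemma measurable_power_delta_le (P : probability T R) M N
    (X : 'I_M * 'I_N -> {RV P >-> R}) K q delta : 0 <= delta -> (0 < q)%N ->
  measurable [set w | power_delta (matrix_at X w) K q <= delta].
Proof.
move=> d0 q0.
rewrite [X in measurable X](_ : _ = \bigcap_(A in [set A : {set 'I_N} | #|A| = K])
  [set w | \tr (gram_defect (matrix_at X w) A ^+ (2 * q)) <= delta ^+ (2 * q)]).
  apply: fin_bigcap_measurable => // A _.
  rewrite -[X in measurable X]setTI; apply: measurable_fun_le => //.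
  exact: measurable_trace_gram_defect.
by apply/seteqP; split=> w /=; [move/power_delta_leP; apply|move=> h; apply/power_delta_leP].
Qed.

Lemma prob_bigsetU_le (P : probability T R) (I : Type) (s : seq I) (F : I -> set T) :
  (forall i, measurable (F i)) ->
  (P (\big[setU/set0]_(i <- s) F i) <= \sum_(i <- s) P (F i))%E.
Proof.
move=> mF; elim: s => [|i s IH]; first by rewrite !big_nil measure0.
rewrite !big_cons; apply: le_trans (measureU2 _ _ _) _ => //.
  exact: bigsetU_measurable.
exact: leeD2l.
Qed.

End MeasurableMatrices.

(** * The union bound *)

Section SampleComplexity.
Context {R : realType}.

Lemma ln_expR1_div (N K : nat) : (0 < K)%N -> (K <= N)%N ->
  1 <= ln (expR 1 * N%:R / K%:R) :> R.
Proof.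
move=> K0 KN; rewrite -[leLHS]expRK ler_ln ?posrE ?expR_gt0//; last first.
  by rewrite divr_gt0 ?mulr_gt0 ?expR_gt0// ltr0n// (leq_trans K0).
by rewrite ler_pdivlMr ?ltr0n// ler_wpM2l ?expR_ge0// ler_nat.
Qed.

(** The bound that makes the failure probability vanish uniformly in [K]. *)
Lemma ln_le_entropy (N K : nat) : (0 < K)%N -> (K <= N)%N ->
  ln N%:R <= K%:R * ln (expR 1 * N%:R / K%:R) :> R.
Proof.
move=> K0 KN; have N0 : (0 < N)%N by exact: leq_trans KN.
have KR : 0 < K%:R :> R by rewrite ltr0n.
have NR : 0 < N%:R :> R by rewrite ltr0n.
have NK : 0 <= ln (N%:R / K%:R) :> R.
  by rewrite ln_ge0// ler_pdivlMr// mul1r ler_nat.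
rewrite -mulrA lnM ?posrE ?expR_gt0 ?divr_gt0// expRK.
have -> : ln N%:R = ln K%:R + ln (N%:R / K%:R) :> R.
  by rewrite -lnM ?posrE ?divr_gt0// mulrC divfK// gt_eqF.
have h1 : ln K%:R <= K%:R :> R by exact/ltW/ln_sublinear.
have h2 : ln (N%:R / K%:R) <= K%:R * ln (N%:R / K%:R) :> R.
  by rewrite ler_peMl// ler1n.
lra.
Qed.

(** The union bound: the number of words against the concentration at a single
    word, the latter with the relative error [3 / 5 * eps] in which
    [81 * eps ^- 2] samples per unit of entropy are available. *)
Lemma union_bound_exponent (N K : nat) (eps : R) (M : nat) :
  (0 < K)%N -> (K <= N)%N -> 0 < eps ->
  81 / eps ^+ 2 * (K%:R * ln (expR 1 * N%:R / K%:R)) <= M%:R ->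
  expR (5 / 2 * K%:R + K%:R * ln (expR 1 * N%:R / K%:R)) *
    (2 * expR (- ((3 / 5 * eps) ^+ 2 / 8 * M%:R)))
  <= 2 * expR (- (ln N%:R / 10)).
Proof.
move=> K0 KN e0; set L := K%:R * _ => hM.
have KL : K%:R <= L by rewrite /L ler_peMr// ln_expR1_div.
have NL : ln N%:R <= L by exact: ln_le_entropy.
have e20 : 0 < eps ^+ 2 by rewrite exprn_gt0.
have h : 81 * L <= eps ^+ 2 * M%:R.
  have E : eps ^+ 2 * (81 / eps ^+ 2 * L) = 81 * L by field; rewrite gt_eqF.
  by rewrite -E; exact: ler_wpM2l (ltW e20) _ _ hM.
have KR : 0 <= K%:R :> R by exact: ler0n.
rewrite mulrCA -expRD ler_wpM2l// ler_expR exprMn; lra.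
Qed.

Lemma exists_prob_threshold (eta : R) : 0 < eta ->
  exists N0 : nat, forall N, (N0 <= N)%N -> (0 < N)%N ->
    2 * expR (- (ln N%:R / 10)) <= eta.
Proof.
move=> eta0; pose x := (2 / eta) ^+ 10.
have x0 : 0 < x by rewrite exprn_gt0// divr_gt0.
exists (Num.truncn x).+1 => N xN N0.
have NR : 0 < N%:R :> R by rewrite ltr0n.
have {}xN : x <= N%:R.
  by apply/ltW/(lt_le_trans (truncnS_gt x)); rewrite ler_nat.
rewrite mulrC -ler_pdivlMr// -(@ler_pXn2r _ 10)// ?nnegrE ?expR_ge0 ?divr_ge0 ?(ltW eta0)//.
rewrite -expRM_natr mulNr divfK// expRN lnK ?posrE//.
rewrite -[eta / 2]invrK invf_div exprVn lef_pV2 ?posrE//.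
Qed.

End SampleComplexity.

Section SampledMatrix.
Context {R : realType} {d : measure_display} {T : measurableType d}.
Context (P : probability T R) (M N : nat) (X : 'I_M * 'I_N -> {RV P >-> R}).

(** Off the union of the bad events of the admissible words, every lattice
    vector needed by [power_delta_of_lattice] is nearly preserved. *)
Lemma prob_power_delta_gt K q delta : gaussian_matrix X ->
  0 < delta -> delta < 1 -> (0 < q)%N -> (0 < K)%N -> (K <= N)%N -> (0 < M)%N ->
  81 / delta ^+ 2 * K%:R `^ (1 + q%:R^-1) * ln (expR 1 * N%:R / K%:R) <= M%:R ->
  (P (~` [set w | power_delta (matrix_at X w) K q <= delta]%R) <=
   (2 * expR (- (ln N%:R / 10)))%:E)%E.
Proof.
move=> gX d0 d1 q0 K0 KN M0 hM.
have KR : 0 < K%:R :> R by rewrite ltr0n.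
have Kp : 0 < K%:R `^ (2 * q)%:R^-1 :> R by rewrite powR_gt0.
pose eps := delta / K%:R `^ (2 * q)%:R^-1.
have e0 : 0 < eps by rewrite divr_gt0.
have e1 : eps <= 1.
  rewrite ler_pdivrMr// mul1r (le_trans (ltW d1))//.
  by rewrite -[leLHS](powRr0 K%:R) ler_powR ?ler1n.
pose a := 3 / 5 * eps.
have a0 : 0 < a by rewrite mulr_gt0.
have a1 : a <= 3 / 5 by rewrite /a; lra.
have {}hM : 81 / eps ^+ 2 * (K%:R * ln (expR 1 * N%:R / K%:R)) <= M%:R.
  apply: le_trans hM; rewrite mulrA le_eqVlt; apply/orP; left; apply/eqP.
  congr (_ * _); rewrite powRD ?gt_eqF ?implybT// powRr1 ?(ltW KR)//.
  have -> : K%:R `^ q%:R^-1 = (K%:R `^ (2 * q)%:R^-1) ^+ 2 :> R.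
    rewrite -powR_mulrn ?powR_ge0// -powRrM natrM invfM mulrAC mulVf ?mul1r//.
  by rewrite /eps; field; rewrite !gt_eqF.
pose good := [pred f : word N (2 * K) | (nnz (word_vec f : 'cV[R]_N) <= K)%N &&
  (sqnorm2 (word_vec f : 'cV[R]_N) <= 4 * K%:R)].
(* The zero word has to be excluded: there both sides of the inequality are 0. *)
pose bad (f : word N (2 * K)) := [set w | 0 < sqnorm2 (word_vec f : 'cV[R]_N) /\
  a * sqnorm2 (word_vec f) <=
  `|sqnorm2 (matrix_at X w *m word_vec f) - sqnorm2 (word_vec f)|].
have badE f : bad f = if 0 < sqnorm2 (word_vec f : 'cV[R]_N) then
    [set w | a * sqnorm2 (word_vec f) <=
      `|sqnorm2 (matrix_at X w *m word_vec f) - sqnorm2 (word_vec f)|] else set0.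
  rewrite /bad; case: ifP => h; apply/seteqP; split=> w.
  - by case.
  - by move=> ?; split.
  - by case=> y0; rewrite y0 in h.
  - by [].
have mbad f : measurable (bad f).
  rewrite badE; case: ifP => // _.
  rewrite -[X in measurable X]setTI; apply: measurable_fun_le => //.
  apply: measurableT_comp => //; apply: measurable_funB => //.
  exact: measurable_sqnorm2_matrix_at.
have Pbad f : (P (bad f) <= (2 * expR (- (a ^+ 2 / 8 * M%:R)))%:E)%E.
  rewrite badE; case: ifP => [y0|_]; first exact: chi_square_concentration.
  by rewrite measure0 lee_fin mulr_ge0 ?expR_ge0.
apply: (@le_trans _ _ (P (\big[setU/set0]_(f <- enum good) bad f))).
  apply: le_measure; rewrite ?inE.
  - by apply: measurableC; apply: measurable_power_delta_le => //; exact: ltW.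
  - exact: bigsetU_measurable.
  move=> w /= nw; apply: contrapT => wbad; apply: nw.
  apply: power_delta_of_lattice => // z zl zK z4.
  have [f zf] : exists f : word N (2 * K), z = word_vec f.
    apply: lattice_vector_word => //; apply: le_trans z4 _.
    by rewrite -natrX -natrM ler_nat; nia.
  rewrite -/eps -/a zf; have [y0|y0] := ltP 0 (sqnorm2 (word_vec f : 'cV[R]_N)).
    apply: ltW; rewrite ltNge; apply/negP => h; apply: wbad.
    rewrite -bigcup_seq; exists f; last by split.
    by rewrite /= mem_enum inE -zf zK.
  have /eqP : sqnorm2 (word_vec f : 'cV[R]_N) == 0 by rewrite eq_le y0 sqnorm2_ge0.
  move=> z0; rewrite z0; move/eqP: z0; rewrite sqnorm2_eq0 => /eqP->.
  by rewrite mulmx0 (eqP (_ : sqnorm2 0 == 0)) ?sqnorm2_eq0// subrr normr0 mulr0.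
apply: le_trans (prob_bigsetU_le P _ mbad) _.
apply: (@le_trans _ _ (\sum_(f <- enum good) (2 * expR (- (a ^+ 2 / 8 * M%:R)))%:E)%E).
  by apply: lee_sum => f _.
rewrite sumEFin lee_fin big_const_seq count_predT -cardE iter_addr addr0 -[leLHS]mulr_natl.
apply: le_trans (union_bound_exponent K0 KN e0 hM).
by rewrite ler_wpM2r ?card_words_le_expR// mulr_ge0 ?expR_ge0.
Qed.

End SampledMatrix.

Theorem theorem34 (R : realType) (eta : R) (heta : 0 < eta) :
  exists N0 : nat,
  forall (N : nat) (delta : R) (q K M : nat),
    (N0 <= N)%N ->
    0 < delta -> delta < 1 ->
    (1 <= q)%N ->
    (1 <= K)%N -> (K <= N)%N ->
    (1 <= M)%N ->
    81 / delta ^+ 2 * K%:R `^ (1 + q%:R^-1) * ln (expR 1 * N%:R / K%:R)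
      <= M%:R ->
  forall (d : measure_display) (T : measurableType d) (P : probability T R)
    (Phi : 'I_M * 'I_N -> {RV P >-> R}),
    gaussian_matrix Phi ->
    ((1 - eta)%:E <=
      P [set w | (power_delta (matrix_at Phi w) K q <= delta)%R
                 /\ rip (matrix_at Phi w) K delta])%E.
Proof.
have [N0 N0P] := exists_prob_threshold heta; exists N0.
move=> N delta q K M NN d0 d1 q0 K0 KN M0 hM d T P Phi gPhi.
rewrite [X in P X](_ : _ = [set w | power_delta (matrix_at Phi w) K q <= delta]%R); last first.
  apply/seteqP; split=> w /=; first by case.
  by move=> h; split=> //; apply: rip_of_power_delta h => //; exact: ltW.
have mE := measurable_power_delta_le Phi K (ltW d0) q0.
rewrite -[X in P X]setCK probability_setC; last exact: measurableC.
rewrite EFinB; apply: leeB => //.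
apply: le_trans (prob_power_delta_gt gPhi d0 d1 q0 K0 KN M0 hM) _.
by rewrite lee_fin; apply: N0P => //; exact: leq_trans KN.
Qed.
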